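(* Let $n\ge 2$ be an integer, let $$u(z)=\frac{1}{2\pi i}\int_{C}\exp\left\{-wz+\frac{1}{n+1}w^{n+1}\right\}\,dw,$$ let $\beta_1,\beta_2,\ldots,\beta_{n+1}$ be the $n+1$ distinct $(n+1)$-th roots of unity, and set $f_j(z)=u(\beta_j z)$ for $j=1,2,\ldots,n+1$. Then the functions $f_1,f_2,\ldots,f_{n+1}$ are solutions of order $1+\frac1n$ of the differential equation $$f^{(n)}+(-1)^{n+1}zf=0,$$ and any $n$ of these $n+1$ functions are linearly independent.
   Context: The contour $C$ runs from $\infty$ to $0$ along the ray $\arg w=-\pi/(n+1)$ and then from $0$ to $\infty$ along the ray $\arg w=\pi/(n+1)$. The order of an entire function $f$ is $\rho(f)=\limsup_{r\to\infty}\frac{\log\log M(r,f)}{\log r}$, where $M(r,f)=\max_{|z|=r}|f(z)|$. Linear independence is over $\mathbb{C}$. *)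

(* Defs.v *)
(* Stdlib reals and Coquelicot. *)
From Stdlib Require Import Reals.
From Coquelicot Require Import Coquelicot.

Open Scope R_scope.

Definition Cexp (z : C) : C :=
  (exp (Re z) * cos (Im z), exp (Re z) * sin (Im z)).

Definition Cdir (theta : R) : C := (cos theta, sin theta).

(* Pullback of [g w dw] under the parametrization [w = r * exp (i theta)]. *)
Definition ray_pullback (theta : R) (g : C -> C) (r : R) : C :=
  (g (r * Cdir theta) * Cdir theta)%C.

(* Integral of [g] along the contour that comes in from infinity to 0 on the
   ray [arg w = - PI / (n + 1)] and leaves from 0 to infinity on the ray
   [arg w = PI / (n + 1)].  Both halves are improper Riemann integrals; the
   first one has its lower limit at [+oo] and its upper limit at 0. *)
Definition contour_integral (n : nat) (g : C -> C) : C :=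
  Cplus
    (RInt_gen (V := C_R_CompleteNormedModule)
       (ray_pullback (- (PI / INR (n + 1))) g)
       (Rbar_locally p_infty) (at_point 0))
    (RInt_gen (V := C_R_CompleteNormedModule)
       (ray_pullback (PI / INR (n + 1)) g)
       (at_point 0) (Rbar_locally p_infty)).

Definition u (n : nat) (z : C) : C :=
  (1 / (2 * PI * Ci) *
   contour_integral n
     (fun w : C => Cexp (- (w * z) + 1 / INR (n + 1) * w ^ (n + 1))))%C.

Fixpoint C_derive_n (f : C -> C) (k : nat) (z : C) : C :=
  match k with
  | O => f z
  | S k' => C_derive (C_derive_n f k') z
  end.

(* [C_derive] is total, so existence of the complex derivatives up to order
   [n] is required separately; for [0 < n] it says in particular that [f] is
   entire. *)
Definition is_solution (n : nat) (f : C -> C) : Prop :=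
  (forall (k : nat) (z : C), (k < n)%nat ->
     ex_derive (K := C_AbsRing) (V := C_NormedModule) (C_derive_n f k) z) /\
  (forall z : C, (C_derive_n f n z + (-1) ^ (n + 1) * z * f z = 0)%C).

Definition is_max_modulus (f : C -> C) (r M : R) : Prop :=
  (exists z : C, Cmod z = r /\ Cmod (f z) = M) /\
  (forall z : C, Cmod z = r -> Cmod (f z) <= M).

(* Upper limit of [phi r] as [r] tends to [+oo], patterned on
   [is_LimSup_seq]. *)
Definition is_LimSup_p_infty (phi : R -> R) (l : Rbar) : Prop :=
  match l with
  | Finite l =>
      forall eps : posreal,
        (forall A : R, exists r : R, A <= r /\ l - eps < phi r) /\
        (exists A : R, forall r : R, A <= r -> phi r < l + eps)
  | p_infty => forall M A : R, exists r : R, A <= r /\ M < phi r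
  | m_infty => forall M : R, exists A : R, forall r : R, A <= r -> phi r < M
  end.

(* The maximum modulus function is determined by [f] on [r > 0], so the
   existential over [M] leaves no freedom in the upper limit. *)
Definition is_order (f : C -> C) (rho : Rbar) : Prop :=
  exists M : R -> R,
    (forall r : R, 0 < r -> is_max_modulus f r (M r)) /\
    is_LimSup_p_infty (fun r : R => ln (ln (M r)) / ln r) rho.

Definition lin_indep (m : nat) (g : nat -> C -> C) : Prop :=
  forall c : nat -> C,
    (forall z : C, sum_n_m (fun k : nat => (c k * g k z)%C) 1 m = RtoC 0) ->
    forall k : nat, (1 <= k <= m)%nat -> c k = RtoC 0.

(* Main.v *)
(* On either ray of the contour the factor [exp (w^(n+1) / (n+1))] equals
   [exp (- r^(n+1) / (n+1))], which dominates every exponential [exp (X r)], so the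
   integral may be differentiated under the integral sign.  Since [z - w^n] times the
   integrand is a total derivative (in [w]), [f_j] satisfies the equation; the
   boundary terms at 0 of the two rays cancel.

   For the order, write [|z| = s^n].  Young's inequality bounds the exponent by a
   multiple of [s^(n+1)] minus [r].  Conversely, choose [arg z] so that the integrand
   is positive along one ray: the other ray then contributes exponentially less, and
   the range [s/2 <= r <= s] gives a lower bound [exp (s^(n+1) / 8)].

   A linear relation can be differentiated [n - 1] times at 0.  There
   [f_j^(k)(0) = beta_j^k u^(k)(0)], and [u^(k)(0)] is a nonzero multiple of
   [sin ((k+1) PI / (n+1))], which does not vanish for [k < n]; the relation becomes
   an invertible Vandermonde system. *)

Require Import Defs.
From Stdlib Require Import Reals Lra Lia IndefiniteDescription.
From Coquelicot Require Import Coquelicot.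

(** * Improper integrals of exponentially decaying functions *)

Definition ray_int (f : R -> C) : C :=
  RInt_gen (V := C_R_CompleteNormedModule) f (at_point 0) (Rbar_locally p_infty).

(** Continuity is asked of each component, so that the real integration theory applies to [Re] and
    [Im] separately. *)
Definition cont_C (f : R -> C) : Prop :=
  (forall r, continuous (fun t => Re (f t)) r) /\
  (forall r, continuous (fun t => Im (f t)) r).

(** The rate 1 is enough because the damping on the rays beats every exponential, and [exp (- r)]
    has integral 1. *)
Definition exp_decay (f : R -> C) : Prop :=
  exists A, forall r, 0 <= r -> Cmod (f r) <= A * exp (- r).

Definition good (f : R -> C) : Prop := cont_C f /\ exp_decay f.

(** A ball around the pair is a product of balls, so the two filter statements combine by
    intersection. *)
Lemma is_RInt_gen_pair (Fa Fb : (R -> Prop) -> Prop)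
  (FFa : Filter Fa) (FFb : Filter Fb) (f : R -> C) (lu lv : R) :
  is_RInt_gen (fun t => Re (f t)) Fa Fb lu ->
  is_RInt_gen (fun t => Im (f t)) Fa Fb lv ->
  is_RInt_gen (V := C_R_NormedModule) f Fa Fb (lu, lv).
Proof.
intros Hu Hv P [eps HP].
assert (Eu : locally lu (ball lu eps)) by now exists eps.
assert (Ev : locally lv (ball lv eps)) by now exists eps.
specialize (Hu _ Eu). specialize (Hv _ Ev). unfold filtermapi in *.
generalize (filter_and _ _ Hu Hv).
apply filter_imp. intros ab [[x [Hx Bx]] [y [Hy By]]].
exists (x, y). split.
- now apply (@is_RInt_fct_extend_pair R_NormedModule R_NormedModule).
- apply HP. now split.
Qed.

Lemma is_RInt_exp_opp (a b : R) : is_RInt (fun r => exp (- r)) a b (exp (- a) - exp (- b)).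
Proof.
replace (exp (- a) - exp (- b)) with (minus (- exp (- b)) (- exp (- a)))
  by (unfold minus, plus, opp; simpl; ring).
apply (is_RInt_derive (V := R_CompleteNormedModule) (fun r => - exp (- r))).
- intros x _. auto_derive; [exact I | ring].
- intros x _. apply (ex_derive_continuous (V := R_NormedModule)). now auto_derive.
Qed.

Lemma exp_opp_lim : is_lim (fun r => exp (- r)) p_infty 0.
Proof.
apply is_lim_comp with m_infty.
- exact is_lim_exp_m.
- replace m_infty with (Rbar_opp p_infty) by reflexivity.
  apply is_lim_opp, is_lim_id.
- now apply filter_forall.
Qed.

(** The filter [at_point 0] pins the lower limit, which leaves an ordinary limit in the upper
    one. *)
Lemma is_RInt_gen_p_infty (f : R -> R) (l : R) :
  (forall b, 0 <= b -> ex_RInt f 0 b) ->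
  is_lim (fun b => RInt f 0 b) p_infty l ->
  is_RInt_gen f (at_point 0) (Rbar_locally p_infty) l.
Proof.
intros Hex Hl P HP.
apply Filter_prod with (Q := fun x => x = 0)
  (R := fun b => 0 <= b /\ P (RInt f 0 b)).
- reflexivity.
- apply filter_and.
  + exists 0. intros x. apply Rlt_le.
  + apply (Hl P HP).
- intros x y -> [Hy HPy]. exists (RInt f 0 y). split; [ | easy].
  apply (RInt_correct (V := R_CompleteNormedModule)), Hex, Hy.
Qed.

Lemma is_RInt_gen_exp_opp :
  is_RInt_gen (fun r => exp (- r)) (at_point 0) (Rbar_locally p_infty) 1.
Proof.
apply is_RInt_gen_p_infty.
- intros b _. eexists. apply is_RInt_exp_opp.
- apply is_lim_ext with (fun b => 1 - exp (- b)).
  + intros b. symmetry. apply is_RInt_unique.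
    replace 1 with (exp (- 0)) by (rewrite Ropp_0; exact exp_0). apply is_RInt_exp_opp.
  + replace (Finite 1) with (Finite (1 - 0)) by (f_equal; ring).
    apply is_lim_minus'; [apply is_lim_const | exact exp_opp_lim].
Qed.

(** Cauchy criterion: the integral over [[a, b]] is at most [A * exp (- a)], which tends to 0. *)
Lemma is_RInt_gen_exp_decay (f : R -> R) (A : R) :
  (forall r, continuous f r) ->
  (forall r, 0 <= r -> Rabs (f r) <= A * exp (- r)) ->
  exists l, is_RInt_gen f (at_point 0) (Rbar_locally p_infty) l.
Proof.
intros Hc HA.
assert (Hex : forall a b, ex_RInt f a b).
{ intros a b. apply (ex_RInt_continuous (V := R_CompleteNormedModule)).
  intros; apply Hc. }
assert (A0 : 0 <= A).
{ generalize (HA 0 (Rle_refl 0)) (Rabs_pos (f 0)).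
  rewrite Ropp_0, exp_0. lra. }
assert (Hb : forall a b, 0 <= a <= b -> Rabs (RInt f a b) <= A * exp (- a)).
{ intros a b Hab.
  apply Rle_trans with (A * (exp (- a) - exp (- b))).
  - apply (norm_RInt_le (V := R_NormedModule) f (fun r => A * exp (- r)) a b).
    + apply Hab.
    + intros x Hx. apply HA. lra.
    + apply (RInt_correct (V := R_CompleteNormedModule)), Hex.
    + apply (is_RInt_scal (V := R_NormedModule)), is_RInt_exp_opp.
  - apply Rmult_le_compat_l; [exact A0|]. generalize (exp_pos (- b)); lra. }
destruct (proj1 (filterlim_locally_cauchy (U := R_CompleteSpace)
  (F := Rbar_locally p_infty) (fun b => RInt f 0 b))) as [l Hl].
2: { exists l. apply is_RInt_gen_p_infty; [intros; apply Hex | exact Hl]. }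
intros eps.
assert (Hlim : is_lim (fun a => A * exp (- a)) p_infty 0).
{ replace (Finite 0) with (Rbar_mult A 0) by (simpl; f_equal; ring).
  apply is_lim_scal_l, exp_opp_lim. }
destruct (Hlim (fun x => Rabs x < eps)) as [M HM].
{ exists eps. intros y Hy. change (Rabs (y - 0) < eps) in Hy.
  now rewrite Rminus_0_r in Hy. }
exists (fun b => 0 <= b /\ M < b). split.
{ apply filter_and; [exists 0; intros x; apply Rlt_le | now exists M]. }
(* Ordered endpoints suffice; the opposite order follows by symmetry of the absolute value. *)
assert (W : forall a b, 0 <= a /\ M < a -> a <= b ->
   Rabs (RInt f 0 b - RInt f 0 a) < eps).
{ intros a b [Ha HMa] Hab.
  assert (E := RInt_Chasles (V := R_CompleteNormedModule) f 0 a b (Hex _ _) (Hex _ _)).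
  change (RInt f 0 a + RInt f a b = RInt f 0 b) in E.
  replace (RInt f 0 b - RInt f 0 a) with (RInt f a b) by lra.
  apply Rle_lt_trans with (A * exp (- a)); [apply Hb; lra|].
  apply Rle_lt_trans with (2 := HM a HMa). apply Rle_abs. }
intros a b Ha Hb'. change (Rabs (RInt f 0 b - RInt f 0 a) < eps).
destruct (Rle_dec a b) as [H|H].
- now apply W.
- rewrite Rabs_minus_sym. apply W; [easy | lra].
Qed.

Lemma Re_le_Cmod (z : C) : Rabs (Re z) <= Cmod z.
Proof. apply Rle_trans with (2 := Rmax_Cmod z), Rmax_l. Qed.

Lemma Im_le_Cmod (z : C) : Rabs (Im z) <= Cmod z.
Proof. apply Rle_trans with (2 := Rmax_Cmod z), Rmax_r. Qed.

Lemma good_Re (f : R -> C) : good f ->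
  exists l, is_RInt_gen (fun t => Re (f t)) (at_point 0) (Rbar_locally p_infty) l.
Proof.
intros [[Hc _] [A HA]]. apply is_RInt_gen_exp_decay with A; [exact Hc|].
intros r Hr. apply Rle_trans with (2 := HA r Hr), Re_le_Cmod.
Qed.

Lemma good_Im (f : R -> C) : good f ->
  exists l, is_RInt_gen (fun t => Im (f t)) (at_point 0) (Rbar_locally p_infty) l.
Proof.
intros [[_ Hc] [A HA]]. apply is_RInt_gen_exp_decay with A; [exact Hc|].
intros r Hr. apply Rle_trans with (2 := HA r Hr), Im_le_Cmod.
Qed.

Lemma ray_int_unique (f : R -> C) (l : C) :
  is_RInt_gen (V := C_R_NormedModule) f (at_point 0) (Rbar_locally p_infty) l ->
  ray_int f = l.
Proof. exact (is_RInt_gen_unique (V := C_R_CompleteNormedModule) f l). Qed.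

Lemma ray_int_pair (f : R -> C) (lu lv : R) :
  is_RInt_gen (fun t => Re (f t)) (at_point 0) (Rbar_locally p_infty) lu ->
  is_RInt_gen (fun t => Im (f t)) (at_point 0) (Rbar_locally p_infty) lv ->
  ray_int f = (lu, lv).
Proof.
intros Hu Hv. apply ray_int_unique, is_RInt_gen_pair; try assumption; apply _.
Qed.

Lemma ray_int_Re (f : R -> C) : good f ->
  is_RInt_gen (fun t => Re (f t)) (at_point 0) (Rbar_locally p_infty) (Re (ray_int f)).
Proof.
intros G. destruct (good_Re f G) as [a Ha], (good_Im f G) as [b Hb].
now rewrite (ray_int_pair f a b Ha Hb).
Qed.

Lemma ray_int_Im (f : R -> C) : good f ->
  is_RInt_gen (fun t => Im (f t)) (at_point 0) (Rbar_locally p_infty) (Im (ray_int f)).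
Proof.
intros G. destruct (good_Re f G) as [a Ha], (good_Im f G) as [b Hb].
now rewrite (ray_int_pair f a b Ha Hb).
Qed.

Lemma ray_int_correct (f : R -> C) : good f ->
  is_RInt_gen (V := C_R_NormedModule) f (at_point 0) (Rbar_locally p_infty) (ray_int f).
Proof.
intros G. rewrite (surjective_pairing (ray_int f)).
apply is_RInt_gen_pair; try apply _; [apply ray_int_Re | apply ray_int_Im]; exact G.
Qed.

Lemma cont_C_plus (f g : R -> C) : cont_C f -> cont_C g -> cont_C (fun r => f r + g r)%C.
Proof.
intros [f1 f2] [g1 g2]. split; intros r.
- apply (continuous_plus (fun t => Re (f t)) (fun t => Re (g t))); auto.
- apply (continuous_plus (fun t => Im (f t)) (fun t => Im (g t))); auto.
Qed.

Lemma cont_C_mult (f g : R -> C) : cont_C f -> cont_C g -> cont_C (fun r => f r * g r)%C.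
Proof.
intros [f1 f2] [g1 g2]. split; intros r.
- apply (continuous_minus (fun t => Re (f t) * Re (g t)) (fun t => Im (f t) * Im (g t)));
  apply (continuous_mult (K := R_AbsRing)); auto.
- apply (continuous_plus (fun t => Re (f t) * Im (g t)) (fun t => Im (f t) * Re (g t)));
  apply (continuous_mult (K := R_AbsRing)); auto.
Qed.

Lemma cont_C_const (c : C) : cont_C (fun _ => c).
Proof. split; intros r; apply continuous_const. Qed.

Lemma cont_C_RtoC (f : R -> R) : (forall r, continuous f r) -> cont_C (fun r => RtoC (f r)).
Proof. intros H; split; intros r; [apply H | apply continuous_const]. Qed.

Lemma cont_C_pow (f : R -> C) (k : nat) : cont_C f -> cont_C (fun r => f r ^ k)%C.
Proof.
intros H. induction k as [|k IH]; simpl; [apply cont_C_const | now apply cont_C_mult].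
Qed.

Lemma cont_C_Cexp (f : R -> C) : cont_C f -> cont_C (fun r => Cexp (f r)).
Proof.
intros [f1 f2]. split; intros r; simpl;
  apply (continuous_mult (K := R_AbsRing)).
- apply continuous_comp; [apply f1 | apply continuous_exp].
- apply continuous_comp; [apply f2 | apply continuous_cos].
- apply continuous_comp; [apply f1 | apply continuous_exp].
- apply continuous_comp; [apply f2 | apply continuous_sin].
Qed.

Lemma good_plus (f g : R -> C) : good f -> good g -> good (fun r => f r + g r)%C.
Proof.
intros [cf [A HA]] [cg [B HB]]. split; [now apply cont_C_plus|].
exists (A + B). intros r Hr. rewrite Rmult_plus_distr_r.
apply Rle_trans with (1 := Cmod_triangle _ _), Rplus_le_compat; auto.
Qed.

Lemma good_scal (c : C) (f : R -> C) : good f -> good (fun r => c * f r)%C.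
Proof.
intros [cf [A HA]]. split; [apply cont_C_mult; [apply cont_C_const | exact cf]|].
exists (Cmod c * A). intros r Hr. rewrite Cmod_mult, Rmult_assoc.
apply Rmult_le_compat_l; [apply Cmod_ge_0 | auto].
Qed.

Lemma ray_int_plus (f g : R -> C) : good f -> good g ->
  ray_int (fun r => f r + g r)%C = (ray_int f + ray_int g)%C.
Proof.
intros Gf Gg. apply ray_int_unique.
apply (is_RInt_gen_plus (V := C_R_NormedModule)); now apply ray_int_correct.
Qed.

Lemma ray_int_scal (c : C) (f : R -> C) : good f ->
  ray_int (fun r => c * f r)%C = (c * ray_int f)%C.
Proof.
intros G. generalize (ray_int_Re f G) (ray_int_Im f G). intros H1 H2.
apply ray_int_pair.
- apply (is_RInt_gen_minus (V := R_NormedModule) (fun t => fst c * Re (f t)) (fun t => snd c * Im (f t)));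
  now apply (is_RInt_gen_scal (V := R_NormedModule)).
- apply (is_RInt_gen_plus (V := R_NormedModule) (fun t => fst c * Im (f t)) (fun t => snd c * Re (f t)));
  now apply (is_RInt_gen_scal (V := R_NormedModule)).
Qed.

(** The majorant enters through its real part, so that another integrand of the same class can serve
    as a bound. *)
Lemma ray_int_le (f g : R -> C) : good f -> good g ->
  (forall r, 0 <= r -> Cmod (f r) <= Re (g r)) -> Cmod (ray_int f) <= Re (ray_int g).
Proof.
intros Gf Gg H.
assert (FP : forall P : R * R -> Prop, (forall b, 0 <= b -> P (0, b)) ->
  filter_prod (at_point 0) (Rbar_locally p_infty) P).
{ intros P HP. apply Filter_prod with (Q := fun x => x = 0) (R := fun b => 0 <= b).
  - reflexivity.
  - exists 0; intros x; apply Rlt_le.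
  - intros x y -> Hy; now apply HP. }
rewrite Cmod_norm.
apply (RInt_gen_norm (V := C_R_CompleteNormedModule) (Fa := at_point 0)
  (Fb := Rbar_locally p_infty) f (fun r => Re (g r))).
- now apply FP.
- apply FP. intros b Hb x Hx. simpl in Hx.
  apply Rle_trans with (2 := H x (proj1 Hx)), Req_le. symmetry. apply Cmod_norm.
- now apply ray_int_correct.
- now apply ray_int_Re.
Qed.

(** The constant [A] survives unchanged because [exp (- r)] integrates to 1. *)
Lemma ray_int_bound (f : R -> C) (A : R) : good f ->
  (forall r, 0 <= r -> Cmod (f r) <= A * exp (- r)) -> Cmod (ray_int f) <= A.
Proof.
intros G H.
assert (Ge : good (fun r => RtoC (A * exp (- r)))).
{ split.
  - apply cont_C_RtoC. intros r. apply (continuous_mult (K := R_AbsRing)); [apply continuous_const|].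
    apply (ex_derive_continuous (V := R_NormedModule)). now auto_derive.
  - exists (Rabs A). intros r _. rewrite Cmod_R, Rabs_mult.
    rewrite (Rabs_pos_eq (exp (- r))); [apply Rle_refl | apply Rlt_le, exp_pos]. }
replace A with (Re (ray_int (fun r => RtoC (A * exp (- r))))).
- now apply ray_int_le.
- rewrite (ray_int_pair _ (scal A 1) 0).
  + unfold scal; simpl; unfold mult; simpl; ring.
  + apply (is_RInt_gen_scal (V := R_NormedModule)), is_RInt_gen_exp_opp.
  (* The vanishing imaginary part is written as 0 times [exp (- r)], whose improper integral is
     already known. *)
  + apply (is_RInt_gen_ext (V := R_NormedModule) (fun r => scal 0 (exp (- r)))).
    * apply filter_forall. intros. unfold scal; simpl; unfold mult; simpl; ring.
    * cut (is_RInt_gen (fun r => scal 0 (exp (- r))) (at_point 0) (Rbar_locally p_infty) (0 * 1));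
        [rewrite Rmult_0_l; intros E; exact E |].
      exact (is_RInt_gen_scal (V := R_NormedModule) _ 0 1 is_RInt_gen_exp_opp).
Qed.

(** Nonnegativity lets everything outside [[x, y]] be dropped. If the integral fell below the bound,
    some truncation beyond [y] would fall below it as well. *)
Lemma ray_int_lower (f : R -> C) (x y c : R) : good f ->
  (forall r, 0 <= r -> 0 <= Re (f r)) -> 0 <= x <= y ->
  (forall r, x <= r <= y -> c <= Re (f r)) ->
  c * (y - x) <= Re (ray_int f).
Proof.
intros G Hp Hxy Hc.
apply Rnot_lt_le; intros Hlt.
set (l := Re (ray_int f)) in *.
assert (Heps : 0 < c * (y - x) - l) by lra.
destruct (ray_int_Re f G (ball l (mkposreal _ Heps)))
  as [Q S HQ [M HM] HQS].
{ now exists (mkposreal _ Heps). }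
(* [b] lies past the threshold [M] of the limit and is at least [y], so the truncated integral
   contains the whole window. *)
set (b := Rmax (M + 1) y).
destruct (HQS 0 b HQ) as [v [Hv Bv]].
{ apply HM. generalize (Rmax_l (M + 1) y). fold b. lra. }
simpl in Hv.
assert (Hby : y <= b) by apply Rmax_r.
assert (Hex : forall s t, ex_RInt (fun t => Re (f t)) s t).
{ intros s t. apply (ex_RInt_continuous (V := R_CompleteNormedModule)).
  intros; apply G. }
assert (Rabs (v - l) < c * (y - x) - l) by apply Bv.
assert (v < c * (y - x)) by (generalize (Rle_abs (v - l)); lra).
apply (is_RInt_unique (V := R_CompleteNormedModule)) in Hv.
assert (E : v = RInt (fun t => Re (f t)) 0 x + RInt (fun t => Re (f t)) x y
  + RInt (fun t => Re (f t)) y b).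
{ assert (E1 := RInt_Chasles (V := R_CompleteNormedModule) _ 0 y b (Hex _ _) (Hex _ _)).
  assert (E2 := RInt_Chasles (V := R_CompleteNormedModule) _ 0 x y (Hex _ _) (Hex _ _)).
  rewrite <- Hv, <- E1, <- E2. reflexivity. }
assert (0 <= RInt (fun t => Re (f t)) 0 x).
{ apply RInt_ge_0; [lra | apply Hex | intros; apply Hp; lra]. }
assert (0 <= RInt (fun t => Re (f t)) y b).
{ apply RInt_ge_0; [lra | apply Hex | intros; apply Hp; lra]. }
assert (c * (y - x) <= RInt (fun t => Re (f t)) x y).
{ replace (c * (y - x)) with (RInt (fun _ => c) x y)
    by (rewrite RInt_const; unfold scal; simpl; unfold mult; simpl; ring).
  apply RInt_le; [lra | apply ex_RInt_const | apply Hex | intros; apply Hc; lra]. }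
lra.
Qed.

(** * The moments of the damped exponential *)

(* The value of [exp (w ^ (n + 1) / (n + 1))] at distance [r] from 0 on either ray
   of the contour, where [w ^ (n + 1) = - r ^ (n + 1)]. *)
Definition damp (n : nat) (r : R) : R := exp (- (r ^ (n + 1) / INR (n + 1))).

(** Each differentiation in [c] brings down one factor [r], so [r ^ k] marks the [k]-th
    derivative. *)
Definition kern (n k : nat) (c : C) (r : R) : C :=
  (RtoC r ^ k * Cexp (c * r) * RtoC (damp n r))%C.

Definition moment (n k : nat) (c : C) : C := ray_int (kern n k c).

Lemma INR_succ_pos (n : nat) : 0 < INR (n + 1).
Proof. apply lt_0_INR; lia. Qed.

Lemma Cexp_plus (x y : C) : Cexp (x + y) = (Cexp x * Cexp y)%C.
Proof.
destruct x as [x1 x2], y as [y1 y2]. unfold Cexp, Cplus, Cmult; simpl.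
rewrite exp_plus, cos_plus, sin_plus. f_equal; ring.
Qed.

Lemma Cexp_RtoC (x : R) : Cexp (RtoC x) = RtoC (exp x).
Proof. unfold Cexp; simpl. rewrite cos_0, sin_0. unfold RtoC. f_equal; ring. Qed.

Lemma Cmod_Cexp (z : C) : Cmod (Cexp z) = exp (Re z).
Proof.
unfold Cexp, Cmod; simpl fst; simpl snd.
replace (_ + _) with (exp (Re z) ^ 2).
- rewrite sqrt_pow2; [reflexivity | apply Rlt_le, exp_pos].
- generalize (sin2_cos2 (Im z)); unfold Rsqr; intros H. 
  transitivity (exp (Re z) ^ 2 * (sin (Im z) * sin (Im z) + cos (Im z) * cos (Im z)));
  [rewrite H; ring | ring].
Qed.

Lemma exp_le_compat (x y : R) : x <= y -> exp x <= exp y.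
Proof. intros [H| ->]; [now apply Rlt_le, exp_increasing | apply Rle_refl]. Qed.

Lemma damp_pos (n : nat) (r : R) : 0 < damp n r.
Proof. apply exp_pos. Qed.

Lemma Cmod_kern (n k : nat) (c : C) (r : R) : 0 <= r ->
  Cmod (kern n k c r) = r ^ k * exp (Re c * r) * damp n r.
Proof.
intros Hr. unfold kern. rewrite !Cmod_mult, Cmod_Cexp, <- RtoC_pow, !Cmod_R.
rewrite (Rabs_pos_eq (r ^ k)) by now apply pow_le.
rewrite (Rabs_pos_eq (damp n r)) by apply Rlt_le, damp_pos.
now replace (Re (c * r)%C) with (Re c * r) by (unfold Re; simpl; ring).
Qed.

(** Young's inequality with crude constants, by cases at [r = 2 * N * s]. Below, [2 * r * s ^ n] is
    at most the right-hand side; above, [r ^ n >= 2 * N * s ^ n] lets the damping absorb it. The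
    factor 2 leaves room for an additional decay [exp (- r)]. *)
Lemma young_pow (n : nat) (r s : R) : (1 <= n)%nat -> 0 <= r -> 0 <= s ->
  2 * r * s ^ n - r ^ (n + 1) / INR (n + 1) <= 4 * INR (n + 1) * s ^ (n + 1).
Proof.
intros Hn Hr Hs. set (N := INR (n + 1)).
assert (HN : 1 < N).
{ unfold N. rewrite plus_INR. apply le_INR in Hn. simpl in *. lra. }
rewrite !pow_add, !pow_1.
assert (P1 : 0 <= s ^ n) by now apply pow_le.
assert (P2 : 0 <= r ^ n) by now apply pow_le.
destruct (Rle_dec r (2 * N * s)) as [H|H].
- assert (0 <= r ^ n * r / N).
  { apply Rmult_le_pos; [now apply Rmult_le_pos | apply Rlt_le, Rinv_0_lt_compat; lra]. }
  assert (r * s ^ n <= 2 * N * s * s ^ n) by now apply Rmult_le_compat_r.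
  nra.
- apply Rnot_le_lt in H.
  assert (Hk : 2 * N * s ^ n <= r ^ n).
  { apply Rle_trans with ((2 * N * s) ^ n).
    - rewrite Rpow_mult_distr. apply Rmult_le_compat_r; [exact P1|].
      rewrite <- (pow_1 (2 * N)) at 1. apply Rle_pow; [lra | exact Hn].
    - apply pow_incr; split; [ | lra].
      apply Rmult_le_pos; lra. }
  assert (2 * r * s ^ n <= r ^ n * r / N).
  { apply Rmult_le_reg_r with N; [lra|].
    replace (r ^ n * r / N * N) with (r ^ n * r) by (field; lra).
    apply Rmult_le_compat_r with (r := r) in Hk; nra. }
  assert (0 <= 4 * N * (s ^ n * s)) by (apply Rmult_le_pos; [lra | now apply Rmult_le_pos]).
  lra.
Qed.

Lemma pow_le_exp (k : nat) (r : R) : 0 <= r -> r ^ k <= exp (INR k * r).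
Proof.
intros Hr. induction k as [|k IH].
- simpl. rewrite Rmult_0_l, exp_0. lra.
- rewrite S_INR. replace ((INR k + 1) * r) with (r + INR k * r) by ring.
  rewrite exp_plus. simpl. apply Rmult_le_compat; [exact Hr | now apply pow_le | | exact IH].
  generalize (exp_ineq1_le r). lra.
Qed.

Lemma damp_decay (n k : nat) (X : R) : (1 <= n)%nat ->
  exists A, forall r, 0 <= r -> r ^ k * exp (X * r) * damp n r <= A * exp (- r).
Proof.
(* As [s >= 1], the power [s ^ n] dominates [X + INR k + 1]: the rate [X], the cost [INR k] of
   bounding [r ^ k] by an exponential, and 1 for the decay. *)
intros Hn. set (s := Rmax 1 (X + INR k + 1)).
exists (exp (4 * INR (n + 1) * s ^ (n + 1))). intros r Hr.
apply Rle_trans with (exp (INR k * r) * exp (X * r) * damp n r).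
- apply Rmult_le_compat_r; [apply Rlt_le, damp_pos|].
  apply Rmult_le_compat_r; [apply Rlt_le, exp_pos|].
  now apply pow_le_exp.
- unfold damp. rewrite <- !exp_plus. apply exp_le_compat.
  assert (S1 : 1 <= s) by apply Rmax_l.
  assert (S2 : X + INR k + 1 <= s) by apply Rmax_r.
  generalize (young_pow n r s Hn Hr ltac:(lra)).
  assert (s <= s ^ n) by (rewrite <- (pow_1 s) at 1; now apply Rle_pow).
  assert (r * (X + INR k + 1) <= r * s ^ n) by (apply Rmult_le_compat_l; lra).
  assert (0 <= r * s ^ n) by (apply Rmult_le_pos; lra).
  lra.
Qed.

Lemma good_kern (n k : nat) (c : C) : (1 <= n)%nat -> good (kern n k c).
Proof.
intros Hn. split.
- apply cont_C_mult; [apply cont_C_mult|].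
  + apply cont_C_pow, cont_C_RtoC. intros r; apply continuous_id.
  + apply cont_C_Cexp, cont_C_mult; [apply cont_C_const|].
    apply cont_C_RtoC. intros r; apply continuous_id.
  + apply cont_C_RtoC. intros r.
    apply (ex_derive_continuous (V := R_NormedModule)). unfold damp. now auto_derive.
- destruct (damp_decay n k (Re c) Hn) as [A HA]. exists A. intros r Hr.
  rewrite Cmod_kern by exact Hr. now apply HA.
Qed.

(** * Taylor bounds for the real and complex exponential *)

(** The inequality [1 + t <= exp t] at [t = x] and [t = - x] gives [x <= exp x - 1 <= x * exp x]. *)
Lemma exp_taylor1 (x : R) : Rabs (exp x - 1) <= Rabs x * exp (Rabs x).
Proof.
generalize (exp_ineq1_le x) (exp_ineq1_le (- x)) (exp_pos x) (exp_Ropp x).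
intros H1 H2 H3 H4.
assert (H5 : exp x - 1 <= x * exp x).
{ assert (exp (- x) * exp x = 1) by (rewrite H4; field; lra). nra. }
unfold Rabs. destruct (Rcase_abs x), (Rcase_abs (exp x - 1));
  generalize (exp_ineq1_le (- x)); nra.
Qed.

(** Here [0 <= exp x - 1 - x <= x * (exp x - 1)], and the first-order bound handles the last
    factor. *)
Lemma exp_taylor2 (x : R) : Rabs (exp x - 1 - x) <= x ^ 2 * exp (Rabs x).
Proof.
generalize (exp_ineq1_le x) (exp_taylor1 x). intros H1 H2.
rewrite Rabs_pos_eq by lra.
assert (H5 : exp x - 1 <= x * exp x).
{ assert (exp (- x) * exp x = 1) by (rewrite <- exp_plus, Rplus_opp_l; apply exp_0).
  generalize (exp_ineq1_le (- x)) (exp_pos x). nra. }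
destruct (Rle_dec 0 x) as [H|H].
- rewrite (Rabs_pos_eq x) in * by exact H.
  rewrite Rabs_pos_eq in H2 by lra.
  generalize (exp_ineq1_le x). intros. nra.
- generalize (exp_ineq1_le (Rabs x)) (Rabs_pos x). intros. nra.
Qed.

(** [1 - cos y] is twice the square of [sin (y / 2)], and the mean value theorem bounds that sine by
    its argument. *)
Lemma one_minus_cos_le (y : R) : Rabs (cos y - 1) <= y ^ 2.
Proof.
assert (S : Rabs (sin (y / 2)) <= Rabs (y / 2)).
{ destruct (MVT_gen sin 0 (y / 2) cos) as [c [_ Hc]].
  - intros x _. apply is_derive_Reals, derivable_pt_lim_sin.
  - intros x _. apply continuity_sin.
  - rewrite sin_0, !Rminus_0_r in Hc. rewrite Hc, Rabs_mult.
    assert (Rabs (cos c) <= 1) by (apply Rabs_le, COS_bound).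
    generalize (Rabs_pos (y / 2)); nra. }
replace y with (2 * (y / 2)) at 1 by field. rewrite cos_2a_sin.
apply Rsqr_le_abs_1 in S. unfold Rsqr in S.
rewrite Rabs_left1; nra.
Qed.

(** Mean value theorem for [sin t - t]: its derivative at the intermediate [c] is at most
    [2 * Rabs c] in absolute value, by the quadratic bound when [Rabs c <= 1] and trivially
    otherwise. *)
Lemma sin_taylor1 (y : R) : Rabs (sin y - y) <= 2 * y ^ 2.
Proof.
destruct (MVT_gen (fun t => sin t - t) 0 y (fun t => cos t - 1)) as [c [Hc E]].
- intros x _. auto_derive; [exact I | ring].
- intros x _. apply derivable_continuous_pt. reg.
- rewrite sin_0, !Rminus_0_r in E. rewrite E, Rabs_mult.
  assert (H1 : Rabs c <= Rabs y).
  { unfold Rmin, Rmax in Hc. destruct (Rle_dec 0 y);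
    [rewrite !Rabs_pos_eq | rewrite !Rabs_left1]; lra. }
  assert (H2 : Rabs (cos c - 1) <= 2 * Rabs c).
  { destruct (Rle_dec (Rabs c) 1) as [H|H].
    - apply Rle_trans with (1 := one_minus_cos_le c). rewrite <- pow2_abs.
      generalize (Rabs_pos c); nra.
    - generalize (COS_bound c). intros. rewrite Rabs_left1; lra. }
  rewrite <- (pow2_abs y). generalize (Rabs_pos y) (Rabs_pos c). nra.
Qed.

Lemma Cmod_le_Re_Im (z : C) : Cmod z <= Rabs (Re z) + Rabs (Im z).
Proof.
replace z with (RtoC (Re z) + Ci * RtoC (Im z))%C at 1
  by (destruct z; unfold Cplus, Cmult, Ci, RtoC; simpl; f_equal; ring).
apply Rle_trans with (1 := Cmod_triangle _ _).
rewrite Cmod_mult, !Cmod_R.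
replace (Cmod Ci) with 1; [lra|].
unfold Cmod, Ci; simpl. replace (0 * (0 * 1) + 1 * (1 * 1)) with 1 by ring.
symmetry; apply sqrt_1.
Qed.

(** The real and imaginary parts split as [exp x * (cos y - 1) + (exp x - 1 - x)] and
    [exp x * (sin y - y) + (exp x - 1) * y]. The four errors total 5 times [m ^ 2 * exp m]; 6 is a
    rounding. *)
Lemma Cexp_taylor2 (c : C) :
  Cmod (Cexp c - 1 - c)%C <= 6 * Cmod c ^ 2 * exp (Cmod c).
Proof.
apply Rle_trans with (1 := Cmod_le_Re_Im _).
assert (Hx := Re_le_Cmod c). assert (Hy := Im_le_Cmod c).
set (m := Cmod c) in *.
destruct c as [x y]; simpl in Hx, Hy |- *.
assert (M1 : 1 <= exp m) by (generalize (exp_ineq1_le m) (Rabs_pos x); lra).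
assert (M2 : exp (Rabs x) <= exp m) by now apply exp_le_compat.
assert (M3 : exp x <= exp m) by (apply exp_le_compat; generalize (Rle_abs x); lra).
assert (X2 : x ^ 2 <= m ^ 2) by (rewrite <- pow2_abs; apply pow_incr; split; [apply Rabs_pos | lra]).
assert (Y2 : y ^ 2 <= m ^ 2) by (rewrite <- pow2_abs; apply pow_incr; split; [apply Rabs_pos | lra]).
assert (Px := Rabs_pos x). assert (Py := Rabs_pos y). assert (Ex := exp_pos x).
assert (X20 := pow2_ge_0 x). assert (Y20 := pow2_ge_0 y).
assert (A1 : Rabs (exp x * (cos y - 1)) <= m ^ 2 * exp m).
{ rewrite Rabs_mult, (Rabs_pos_eq (exp x)), Rmult_comm by lra.
  apply Rmult_le_compat; [apply Rabs_pos | lra | | lra].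
  apply Rle_trans with (1 := one_minus_cos_le y); lra. }
assert (A2 : Rabs (exp x - 1 - x) <= m ^ 2 * exp m).
{ apply Rle_trans with (1 := exp_taylor2 x).
  apply Rmult_le_compat; try lra. apply Rlt_le, exp_pos. }
assert (A3 : Rabs (exp x * (sin y - y)) <= 2 * m ^ 2 * exp m).
{ rewrite Rabs_mult, (Rabs_pos_eq (exp x)), Rmult_comm by lra.
  apply Rmult_le_compat; [apply Rabs_pos | lra | | lra].
  apply Rle_trans with (1 := sin_taylor1 y); lra. }
assert (A4 : Rabs ((exp x - 1) * y) <= m ^ 2 * exp m).
{ rewrite Rabs_mult.
  apply Rle_trans with (Rabs x * exp (Rabs x) * Rabs y).
  - apply Rmult_le_compat_r; [exact Py | apply exp_taylor1].
  - replace (Rabs x * exp (Rabs x) * Rabs y) with (Rabs x * Rabs y * exp (Rabs x)) by ring.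
    apply Rmult_le_compat; [now apply Rmult_le_pos | apply Rlt_le, exp_pos | | exact M2].
    simpl. rewrite Rmult_1_r. now apply Rmult_le_compat. }
replace (exp x * cos y + - (1) + - x) with (exp x * (cos y - 1) + (exp x - 1 - x)) by ring.
replace (exp x * sin y + - 0 + - y) with (exp x * (sin y - y) + (exp x - 1) * y) by ring.
generalize (Rabs_triang (exp x * (cos y - 1)) (exp x - 1 - x)).
generalize (Rabs_triang (exp x * (sin y - y)) ((exp x - 1) * y)).
assert (0 <= m ^ 2 * exp m) by (apply Rmult_le_pos; lra).
lra.
Qed.

(* Complex differentiability with a quadratic remainder, a form that passes under
   the integral sign by domination alone. *)
Definition qderive (f : C -> C) (z l : C) : Prop :=
  exists A, forall h, Cmod h <= 1 ->
    Cmod (f (z + h) - f z - h * l)%C <= A * Cmod h ^ 2.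

Lemma qderive_is_derive (f : C -> C) (z l : C) :
  qderive f z l -> is_derive (K := C_AbsRing) (V := C_NormedModule) f z l.
Proof.
intros [A HA]. split.
- apply is_linear_scal_l.
- intros x Hx eps.
  replace x with z.
  2: { apply (is_filter_lim_locally_unique (V := AbsRing_NormedModule C_AbsRing)), Hx. }
  (* The [+ 1] avoids a division by zero, and [Rabs] is there since the sign of [A] is not
     prescribed. *)
  set (d := Rmin 1 (eps / (Rabs A + 1))).
  assert (Hd : 0 < d).
  { apply Rmin_pos; [lra|]. apply Rdiv_lt_0_compat; [apply eps | generalize (Rabs_pos A); lra]. }
  exists (mkposreal d Hd). intros y Hy.
  assert (Hyz : Cmod (y - z)%C < d) by exact Hy.
  change (Cmod (f y - f z - (y - z) * l)%C <= eps * Cmod (y - z)%C).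
  replace (f y) with (f (z + (y - z))%C) by (f_equal; ring).
  set (h := (y - z)%C) in *.
  assert (H1 : Cmod h <= 1) by (apply Rlt_le, Rlt_le_trans with (1 := Hyz), Rmin_l).
  apply Rle_trans with (1 := HA h H1).
  simpl. rewrite Rmult_1_r, <- Rmult_assoc.
  apply Rmult_le_compat_r; [apply Cmod_ge_0|].
  assert (H2 : Cmod h <= eps / (Rabs A + 1)) by (apply Rlt_le, Rlt_le_trans with (1 := Hyz), Rmin_r).
  apply Rle_trans with ((Rabs A + 1) * (eps / (Rabs A + 1))).
  + apply Rle_trans with (Rabs A * Cmod h).
    * apply Rmult_le_compat_r; [apply Cmod_ge_0 | apply Rle_abs].
    * apply Rmult_le_compat; [apply Rabs_pos | apply Cmod_ge_0 | lra | exact H2].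
  + right. field. generalize (Rabs_pos A); lra.
Qed.

Lemma qderive_plus (f g : C -> C) (z l m : C) :
  qderive f z l -> qderive g z m -> qderive (fun z => f z + g z)%C z (l + m).
Proof.
intros [A HA] [B HB]. exists (A + B). intros h Hh.
replace (f (z + h) + g (z + h) - (f z + g z) - h * (l + m))%C
  with ((f (z + h) - f z - h * l) + (g (z + h) - g z - h * m))%C by ring.
rewrite Rmult_plus_distr_r.
apply Rle_trans with (1 := Cmod_triangle _ _), Rplus_le_compat; auto.
Qed.

Lemma qderive_scal (c : C) (f : C -> C) (z l : C) :
  qderive f z l -> qderive (fun z => c * f z)%C z (c * l).
Proof.
intros [A HA]. exists (Cmod c * A). intros h Hh.
replace (c * f (z + h) - c * f z - h * (c * l))%C
  with (c * (f (z + h) - f z - h * l))%C by ring.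
rewrite Cmod_mult, Rmult_assoc. apply Rmult_le_compat_l; [apply Cmod_ge_0 | auto].
Qed.

(** Multiplication by [a] of modulus 1 keeps increments in the unit disc and preserves their size,
    so the same constant [A] serves. *)
Lemma qderive_comp_scal (a : C) (f : C -> C) (z l : C) : Cmod a = 1 ->
  qderive f (a * z)%C l -> qderive (fun z => f (a * z))%C z (a * l).
Proof.
intros Ha [A HA]. exists A. intros h Hh.
replace (f (a * (z + h)) - f (a * z) - h * (a * l))%C
  with (f (a * z + a * h) - f (a * z) - (a * h) * l)%C
  by (rewrite Cmult_plus_distr_l; ring).
replace (Cmod h) with (Cmod (a * h)) in * by (rewrite Cmod_mult, Ha; ring).
now apply HA.
Qed.

(** Differentiation under the integral sign: the remainder integrand is [kern n k c r] times
    [Cexp (h * r) - 1 - h * r], of size [Cmod h ^ 2] times an integrable function independent of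
    [h]. *)
Lemma moment_qderive (n k : nat) (c : C) : (1 <= n)%nat ->
  qderive (moment n k) c (moment n (k + 1) c).
Proof.
intros Hn.
(* Two further powers of [r] come from the Taylor remainder, and the extra rate 1 from
   [exp (Cmod h * r) <= exp r]. *)
destruct (damp_decay n (k + 2) (Cmod c + 1) Hn) as [A HA].
exists (6 * A). intros h Hh.
set (g := fun r : R => (kern n k (c + h) r + (-1) * kern n k c r + (- h) * kern n (k + 1) c r)%C).
assert (G1 := good_kern n k (c + h) Hn).
assert (G2 := good_scal (-1) _ (good_kern n k c Hn)).
assert (G3 := good_scal (- h) _ (good_kern n (k + 1) c Hn)).
assert (G12 := good_plus _ _ G1 G2).
assert (G : good g) by exact (good_plus _ _ G12 G3).
replace (moment n k (c + h) - moment n k c - h * moment n (k + 1) c)%C with (ray_int g).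
2: { unfold g. rewrite (ray_int_plus _ _ G12 G3), (ray_int_plus _ _ G1 G2).
  rewrite !ray_int_scal by now apply good_kern. unfold moment. ring. }
apply ray_int_bound; [exact G|].
intros r Hr. unfold g, kern.
replace (RtoC r ^ k * Cexp ((c + h) * r) * damp n r + -1 * (RtoC r ^ k * Cexp (c * r) * damp n r) +
   - h * (RtoC r ^ (k + 1) * Cexp (c * r) * damp n r))%C
  with (RtoC r ^ k * Cexp (c * r) * damp n r * (Cexp (h * r) - 1 - h * r))%C.
2: { rewrite Cmult_plus_distr_r, Cexp_plus.
  replace (RtoC r ^ (k + 1))%C with (RtoC r ^ k * r)%C; [ring|].
  rewrite <- !RtoC_pow, <- RtoC_mult, pow_add, pow_1. reflexivity. }
rewrite Cmod_mult. fold (kern n k c r). rewrite Cmod_kern by exact Hr.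
assert (Ehr : Cmod (h * r)%C = Cmod h * r) by (rewrite Cmod_mult, Cmod_R, Rabs_pos_eq; trivial).
apply Rle_trans with (r ^ k * exp (Cmod c * r) * damp n r * (6 * (Cmod h * r) ^ 2 * exp r)).
- apply Rmult_le_compat.
  + apply Rmult_le_pos; [apply Rmult_le_pos|]; try (now apply pow_le); apply Rlt_le, exp_pos.
  + apply Cmod_ge_0.
  + apply Rmult_le_compat_r; [apply Rlt_le, damp_pos|].
    apply Rmult_le_compat_l; [now apply pow_le|].
    apply exp_le_compat, Rmult_le_compat_r; [exact Hr|].
    apply Rle_trans with (2 := Re_le_Cmod c), Rle_abs.
  + apply Rle_trans with (1 := Cexp_taylor2 _). rewrite Ehr.
    apply Rmult_le_compat_l.
    * apply Rmult_le_pos; [lra | apply pow2_ge_0].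
    * apply exp_le_compat. nra.
- replace (6 * A * Cmod h ^ 2 * exp (- r)) with (6 * Cmod h ^ 2 * (A * exp (- r))) by ring.
  replace (r ^ k * exp (Cmod c * r) * damp n r * (6 * (Cmod h * r) ^ 2 * exp r))
    with (6 * Cmod h ^ 2 * (r ^ (k + 2) * exp ((Cmod c + 1) * r) * damp n r)).
  + apply Rmult_le_compat_l; [apply Rmult_le_pos; [lra | apply pow2_ge_0] | now apply HA].
  + rewrite pow_add. replace ((Cmod c + 1) * r) with (Cmod c * r + r) by ring.
    rewrite exp_plus, Rpow_mult_distr. ring.
Qed.

(** Fundamental theorem of calculus, with the decay removing the boundary term at infinity. *)
Lemma is_RInt_gen_derive_decay (F f : R -> R) (A : R) :
  (forall r, is_derive F r (f r)) -> (forall r, continuous f r) ->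
  (forall r, 0 <= r -> Rabs (F r) <= A * exp (- r)) ->
  is_RInt_gen f (at_point 0) (Rbar_locally p_infty) (- F 0).
Proof.
intros HF Hf HA.
assert (HI : forall b, is_RInt f 0 b (F b - F 0)).
{ intros b. apply (is_RInt_derive (V := R_CompleteNormedModule) F f); intros; auto. }
apply is_RInt_gen_p_infty.
- intros b _. now exists (F b - F 0).
- apply is_lim_ext with (fun b => F b - F 0).
  + intros b. symmetry. apply (is_RInt_unique (V := R_CompleteNormedModule)), HI.
  + replace (Finite (- F 0)) with (Finite (0 - F 0)) by (f_equal; ring).
    apply is_lim_minus'; [ | apply is_lim_const].
    assert (L : is_lim (fun b => A * exp (- b)) p_infty 0).
    { replace (Finite 0) with (Rbar_mult A 0) by (simpl; f_equal; ring).
      apply is_lim_scal_l, exp_opp_lim. }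
    apply is_lim_le_le_loc with (fun b => - (A * exp (- b))) (fun b => A * exp (- b)).
    * exists 0. intros b Hb. apply Rabs_le_between, HA. lra.
    * replace (Finite 0) with (Rbar_opp 0) by (simpl; f_equal; ring). now apply is_lim_opp.
    * exact L.
Qed.

(* [(c - r ^ n) * exp (c r - r ^ (n + 1) / (n + 1))] is a total derivative. *)
Lemma moment_recurrence (n : nat) (c : C) : (1 <= n)%nat ->
  moment n n c = (c * moment n 0 c + 1)%C.
Proof.
intros Hn.
assert (G0 := good_kern n 0 c Hn). assert (G1 := good_kern n n c Hn).
assert (Gc := good_scal c _ G0). assert (Gm := good_scal (-1) _ G1).
assert (G := good_plus _ _ Gc Gm).
destruct (good_kern n 0 c Hn) as [[K1 K2] [A HA]].
assert (HN := INR_succ_pos n).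
assert (HD : forall r, damp n r = exp (- (r ^ (n + 1) / INR (n + 1)))) by reflexivity.
(* The integrand is the derivative of [kern n 0 c], which equals 1 at 0 and vanishes at infinity;
   hence [0 - 1]. *)
assert (E : ray_int (fun r => c * kern n 0 c r + (-1) * kern n n c r)%C = RtoC (-1)).
{ transitivity ((- Re (kern n 0 c 0), - Im (kern n 0 c 0)) : C).
  2: { unfold kern, damp, Cexp. simpl. rewrite pow_i by lia. unfold Rdiv.
    rewrite !Rmult_0_r, !Rmult_0_l, !Rminus_0_r, !Rplus_0_r, Ropp_0, exp_0, cos_0, sin_0.
    unfold RtoC; simpl. f_equal; ring. }
  apply ray_int_pair.
  - apply is_RInt_gen_derive_decay with (F := fun r => Re (kern n 0 c r)) (A := A).
    + intros r.
      apply is_derive_ext with (fun r => exp (Re c * r - r ^ (n + 1) / INR (n + 1)) * cos (Im c * r)).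
      { intros t. unfold Rminus, kern, Cexp, damp. rewrite exp_plus. simpl.
        unfold Re, Im. rewrite ?Rmult_0_r, ?Rminus_0_r, ?Rplus_0_l. simpl. ring. }
      auto_derive; [exact I|]. unfold kern, Cexp. rewrite <- !RtoC_pow.
      unfold Rminus. rewrite exp_plus.
      replace (pred (n + 1)) with n by lia. simpl. unfold Re, Im. simpl.
      rewrite !Rmult_0_r, ?Rminus_0_r, ?Rplus_0_l. unfold damp, Rdiv.
      field; lra.
    + apply G.
    + intros r Hr. apply Rle_trans with (2 := HA r Hr), Re_le_Cmod.
  - apply is_RInt_gen_derive_decay with (F := fun r => Im (kern n 0 c r)) (A := A).
    + intros r.
      apply is_derive_ext with (fun r => exp (Re c * r - r ^ (n + 1) / INR (n + 1)) * sin (Im c * r)).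
      { intros t. unfold Rminus, kern, Cexp, damp. rewrite exp_plus. simpl.
        unfold Re, Im. rewrite ?Rmult_0_r, ?Rminus_0_r, ?Rplus_0_l. simpl. ring. }
      auto_derive; [exact I|]. unfold kern, Cexp. rewrite <- !RtoC_pow.
      unfold Rminus. rewrite exp_plus.
      replace (pred (n + 1)) with n by lia. simpl. unfold Re, Im. simpl.
      rewrite !Rmult_0_r, ?Rminus_0_r, ?Rplus_0_l. unfold damp, Rdiv.
      field; lra.
    + apply G.
    + intros r Hr. apply Rle_trans with (2 := HA r Hr), Im_le_Cmod. }
rewrite (ray_int_plus _ _ Gc Gm), !ray_int_scal in E by assumption.
unfold moment. replace (ray_int (kern n n c)) with
  (c * ray_int (kern n 0 c) - (c * ray_int (kern n 0 c) + -1 * ray_int (kern n n c)))%C by ring.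
rewrite E. ring.
Qed.

(** * The differential equation *)

Lemma Cdir_plus (s t : R) : Cdir (s + t) = (Cdir s * Cdir t)%C.
Proof.
unfold Cdir, Cmult; simpl. rewrite cos_plus, sin_plus. f_equal; ring.
Qed.

Lemma Cdir_pow (t : R) (k : nat) : (Cdir t ^ k)%C = Cdir (INR k * t).
Proof.
induction k as [|k IH].
- simpl. unfold Cdir. rewrite Rmult_0_l, cos_0, sin_0. reflexivity.
- rewrite S_INR. replace ((INR k + 1) * t) with (t + INR k * t) by ring.
  rewrite Cdir_plus, <- IH. reflexivity.
Qed.

Lemma Cmod_Cdir (t : R) : Cmod (Cdir t) = 1.
Proof.
unfold Cmod, Cdir; simpl fst; simpl snd.
replace (_ + _) with 1; [apply sqrt_1 | ].
rewrite <- (sin2_cos2 t). unfold Rsqr. ring.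
Qed.

Definition theta (n : nat) : R := PI / INR (n + 1).

Lemma Cdir_theta_pow (n : nat) : (Cdir (theta n) ^ (n + 1))%C = RtoC (-1).
Proof.
rewrite Cdir_pow. unfold theta.
replace (INR (n + 1) * (PI / INR (n + 1))) with PI by (field; generalize (INR_succ_pos n); lra).
unfold Cdir. now rewrite cos_PI, sin_PI.
Qed.

Lemma Cdir_opp_theta_pow (n : nat) : (Cdir (- theta n) ^ (n + 1))%C = RtoC (-1).
Proof.
rewrite Cdir_pow. unfold theta.
replace (INR (n + 1) * - (PI / INR (n + 1))) with (- PI) by (field; generalize (INR_succ_pos n); lra).
unfold Cdir. rewrite cos_neg, sin_neg, cos_PI, sin_PI. unfold RtoC. f_equal; ring.
Qed.

(** On [w = r * Cdir s] the exponent [- w * z] is linear in [r]. The direction enters only through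
    [Cdir s ^ (n + 1) = -1], so one statement serves both rays. *)
Lemma ray_pullback_kern (n : nat) (s : R) (z : C) (r : R) :
  (Cdir s ^ (n + 1))%C = RtoC (-1) ->
  ray_pullback s (fun w : C => Cexp (- (w * z) + 1 / INR (n + 1) * w ^ (n + 1)))%C r
  = (Cdir s * kern n 0 (- (Cdir s) * z) r)%C.
Proof.
intros Hs. unfold ray_pullback, kern, damp.
rewrite Cpow_mult_l, Hs, Cexp_plus, <- RtoC_pow.
replace (1 / INR (n + 1) * (RtoC (r ^ (n + 1))%R * RtoC (-1)))%C with (RtoC (- (r ^ (n + 1) / INR (n + 1)))).
- rewrite Cexp_RtoC. replace (- (r * Cdir s * z))%C with (- Cdir s * z * r)%C by ring.
  simpl. ring.
- rewrite <- RtoC_div, <- !RtoC_mult by (generalize (INR_succ_pos n); lra).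
  f_equal. field. generalize (INR_succ_pos n); lra.
Qed.

(** By the chain rule, this is the [k]-th derivative of [moment n 0 (a * z)] in [z]. *)
Definition branch (n k : nat) (a z : C) : C := (a ^ k * moment n k (a * z))%C.

(* The [k]-th derivative of [z |-> u n (b z)], with [a = - Cdir (+- theta n) * b]
   on the two rays, so that [- w b z = r (a z)]. *)
Definition airy (n k : nat) (b z : C) : C :=
  (1 / (2 * PI * Ci) *
   (Cdir (theta n) * branch n k (- Cdir (theta n) * b) z
    + RtoC (-1) * (Cdir (- theta n) * branch n k (- Cdir (- theta n) * b) z)))%C.

Lemma u_airy (n : nat) (b z : C) : (1 <= n)%nat -> u n (b * z) = airy n 0 b z.
Proof.
intros Hn. unfold u, airy, contour_integral. f_equal.
fold (theta n).
set (g := fun w : C => _).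
assert (H : forall s, (Cdir s ^ (n + 1))%C = RtoC (-1) ->
  is_RInt_gen (V := C_R_NormedModule) (ray_pullback s g) (at_point 0) (Rbar_locally p_infty)
    (Cdir s * branch n 0 (- Cdir s * b) z)%C).
{ intros s Hs.
  apply (is_RInt_gen_ext (V := C_R_NormedModule) (fun r => Cdir s * kern n 0 (- Cdir s * (b * z)) r)%C).
  - apply filter_forall. intros ab r _. symmetry. now apply ray_pullback_kern.
  - unfold branch, moment.
    replace (Cdir s * ((- Cdir s * b) ^ 0 * ray_int (kern n 0 (- Cdir s * b * z))))%C
      with (ray_int (fun r => Cdir s * kern n 0 (- Cdir s * (b * z)) r)%C).
    + apply ray_int_correct, good_scal, good_kern, Hn.
    + rewrite ray_int_scal by now apply good_kern. rewrite Cmult_assoc. simpl. ring. }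
assert (H1 := H _ (Cdir_theta_pow n)).
assert (H2 := H _ (Cdir_opp_theta_pow n)).
(* The contour comes in along the lower ray; reversing that integral produces the factor -1 in
   [airy]. *)
apply (is_RInt_gen_swap (V := C_R_NormedModule)) in H2.
assert (E1 := is_RInt_gen_unique (V := C_R_CompleteNormedModule) _ _ H1).
assert (E2 := is_RInt_gen_unique (V := C_R_CompleteNormedModule) _ _ H2).
rewrite E1, E2. unfold opp; simpl.
rewrite Cplus_comm. f_equal.
change (- (Cdir (- theta n) * branch n 0 (- Cdir (- theta n) * b) z) = -1 *
  (Cdir (- theta n) * branch n 0 (- Cdir (- theta n) * b) z))%C. ring.
Qed.

Lemma branch_qderive (n k : nat) (a z : C) : (1 <= n)%nat -> Cmod a = 1 ->
  qderive (branch n k a) z (branch n (S k) a z).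
Proof.
intros Hn Ha. unfold branch.
replace (a ^ S k * moment n (S k) (a * z))%C with (a ^ k * (a * moment n (k + 1) (a * z)))%C.
- apply (qderive_scal (a ^ k) (fun z => moment n k (a * z))), qderive_comp_scal; [exact Ha|].
  now apply moment_qderive.
- replace (k + 1)%nat with (S k) by lia. simpl. ring.
Qed.

Lemma Cmod_ray (t : R) (b : C) : Cmod b = 1 -> Cmod (- Cdir t * b)%C = 1.
Proof. intros Hb. rewrite Cmod_mult, Cmod_opp, Cmod_Cdir, Hb. ring. Qed.

Lemma airy_qderive (n k : nat) (b z : C) : (1 <= n)%nat -> Cmod b = 1 ->
  qderive (airy n k b) z (airy n (S k) b z).
Proof.
intros Hn Hb. unfold airy. apply qderive_scal.
apply (qderive_plus (fun z => Cdir (theta n) * branch n k (- Cdir (theta n) * b) z)%C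
  (fun z => RtoC (-1) * (Cdir (- theta n) * branch n k (- Cdir (- theta n) * b) z))%C).
- now apply qderive_scal, branch_qderive; [ | apply Cmod_ray].
- apply (qderive_scal _ (fun z => (Cdir (- theta n) * branch n k (- Cdir (- theta n) * b) z))%C).
  now apply qderive_scal, branch_qderive; [ | apply Cmod_ray].
Qed.

Lemma C_derive_n_airy (n k : nat) (b : C) (f : C -> C) :
  (1 <= n)%nat -> Cmod b = 1 -> (forall z, f z = airy n 0 b z) ->
  forall z, C_derive_n f k z = airy n k b z.
Proof.
intros Hn Hb Hf. induction k as [|k IH]; intros z; [apply Hf|].
simpl. apply is_C_derive_unique.
apply (is_derive_ext (K := C_AbsRing) (V := C_NormedModule) (airy n k b)).
- intros t. symmetry. apply IH.
- now apply qderive_is_derive, airy_qderive.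
Qed.

(** Each ray alone satisfies an inhomogeneous equation; the constant [a ^ n] is the boundary
    contribution at 0. *)
Lemma branch_ode (n : nat) (a z : C) : (1 <= n)%nat ->
  branch n n a z = (a ^ (n + 1) * z * branch n 0 a z + a ^ n)%C.
Proof.
intros Hn. unfold branch. rewrite moment_recurrence by exact Hn.
replace (a ^ (n + 1))%C with (a ^ n * a)%C.
- simpl. ring.
- rewrite Cpow_add_r. simpl. ring.
Qed.

(** On both rays [a ^ (n + 1) = (-1) ^ n], since [b] and the direction have [(n + 1)]-th powers 1
    and -1. The terms in [z] cancel, and the boundary constants of the two rays are equal, so their
    difference is zero. *)
Lemma airy_ode (n : nat) (b z : C) : (1 <= n)%nat -> (b ^ (n + 1))%C = RtoC 1 ->
  (airy n n b z + RtoC (-1) ^ (n + 1) * z * airy n 0 b z = 0)%C.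
Proof.
intros Hn Hb. unfold airy. rewrite !branch_ode by exact Hn.
assert (Hopp : forall c : C, (- c)%C = (RtoC (-1) * c)%C) by (intros c; ring).
rewrite !(Hopp (Cdir _)).
rewrite !Cpow_mult_l, Cdir_theta_pow, Cdir_opp_theta_pow, Hb.
assert (E1 : (Cdir (theta n) * Cdir (theta n) ^ n = RtoC (-1))%C).
{ rewrite <- (Cdir_theta_pow n), Nat.add_1_r. reflexivity. }
assert (E2 : (Cdir (- theta n) * Cdir (- theta n) ^ n = RtoC (-1))%C).
{ rewrite <- (Cdir_opp_theta_pow n), Nat.add_1_r. reflexivity. }
set (p := branch n 0 (-1 * Cdir (theta n) * b) z).
set (q := branch n 0 (-1 * Cdir (- theta n) * b) z).
set (e := (RtoC (-1) ^ (n + 1))%C). set (e' := (RtoC (-1) ^ n)%C).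
set (K := (1 / _)%C). 
set (d := Cdir (theta n)) in *. set (d' := Cdir (- theta n)) in *.
replace (K * (d * (e * -1 * 1 * z * p + e' * d ^ n * b ^ n)
   + -1 * (d' * (e * -1 * 1 * z * q + e' * d' ^ n * b ^ n))) +
 e * z * (K * (d * p + -1 * (d' * q))))%C
with (K * e' * b ^ n * (d * d ^ n + -1 * (d' * d' ^ n)))%C by ring.
rewrite E1, E2. ring.
Qed.

Lemma unit_root_Cmod (b : C) (n : nat) : (b ^ (n + 1))%C = RtoC 1 -> Cmod b = 1.
Proof.
intros H. apply (f_equal Cmod) in H. rewrite Cmod_pow, Cmod_1 in H.
apply pow_R1 in H. destruct H as [H|H]; [ | lia].
now rewrite Rabs_pos_eq in H by apply Cmod_ge_0.
Qed.

Lemma airy_is_solution (n : nat) (b : C) (f : C -> C) :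
  (1 <= n)%nat -> (b ^ (n + 1))%C = RtoC 1 -> (forall z, f z = airy n 0 b z) ->
  is_solution n f.
Proof.
intros Hn Hb Hf. assert (Hm := unit_root_Cmod b n Hb). split.
- intros k z _. exists (airy n (S k) b z).
  apply (is_derive_ext (K := C_AbsRing) (V := C_NormedModule) (airy n k b)).
  + intros t. symmetry. now apply C_derive_n_airy.
  + now apply qderive_is_derive, airy_qderive.
- intros z. rewrite (C_derive_n_airy n n b f Hn Hm Hf), Hf. now apply airy_ode.
Qed.

(** * Values of the derivatives at the origin *)

(** At [c = 0] the integrand is real and nonnegative, and the window [[1, 2]] already contributes a
    positive amount. *)
Lemma moment_zero_pos (n k : nat) : (1 <= n)%nat -> 0 < Re (moment n k 0).
Proof.
intros Hn.
assert (E : forall r, Re (kern n k 0 r) = r ^ k * damp n r).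
{ intros r. unfold kern. rewrite Cmult_0_l, Cexp_RtoC, exp_0, <- RtoC_pow, Cmult_1_r, <- RtoC_mult.
  reflexivity. }
apply Rlt_le_trans with ((1 * exp (- (2 ^ (n + 1) / INR (n + 1)))) * (2 - 1)).
- rewrite Rmult_1_l. generalize (exp_pos (- (2 ^ (n + 1) / INR (n + 1)))). lra.
- apply ray_int_lower.
  + now apply good_kern.
  + intros r Hr. rewrite E. apply Rmult_le_pos; [now apply pow_le | apply Rlt_le, damp_pos].
  + lra.
  + intros r Hr. rewrite E. apply Rmult_le_compat; try lra.
    * apply Rlt_le, exp_pos.
    * now apply pow_R1_Rle.
    * apply exp_le_compat, Ropp_le_contravar, Rmult_le_compat_r.
      { apply Rlt_le, Rinv_0_lt_compat, INR_succ_pos. }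
      apply pow_incr; lra.
Qed.

(** At 0 the root [b] enters only through [b ^ k], which turns the differentiated relations into a
    Vandermonde system. *)
Lemma airy_at_0 (n k : nat) (b : C) :
  airy n k b 0 = (airy n k 1 0 * b ^ k)%C.
Proof.
unfold airy, branch. rewrite !Cmult_0_r, !Cpow_mult_l, !Cpow_1_l.
ring.
Qed.

Lemma Cmod_airy_factor : Cmod (1 / (2 * PI * Ci))%C = / (2 * PI).
Proof.
assert (HP := PI_RGT_0).
replace (2 * PI * Ci)%C with ((0, 2 * PI) : C)
  by (unfold Cmult, Ci, RtoC; simpl; f_equal; ring).
assert (M : Cmod (0, 2 * PI) = 2 * PI).
{ unfold Cmod; simpl. replace (_ + _) with ((2 * PI) ^ 2) by ring.
  apply sqrt_pow2. lra. }
rewrite Cmod_div, M, Cmod_1.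
- field. lra.
- intros E. injection E. lra.
Qed.

Lemma airy_factor_neq : (1 / (2 * PI * Ci))%C <> 0.
Proof.
intros E. generalize Cmod_airy_factor. rewrite E, Cmod_0.
assert (0 < / (2 * PI)) by (apply Rinv_0_lt_compat; generalize PI_RGT_0; lra).
lra.
Qed.

(** Up to nonzero factors the value is [Cdir (theta n) ^ (k + 1)] minus its conjugate, with
    imaginary part twice [sin ((k + 1) * theta n)]. This angle lies strictly between 0 and [PI] as
    [k < n]. *)
Lemma airy_at_0_neq (n k : nat) : (1 <= n)%nat -> (k < n)%nat -> airy n k 1 0 <> 0%C.
Proof.
intros Hn Hk. unfold airy, branch. rewrite !Cmult_0_r, !Cmult_1_r.
set (m := moment n k 0).
assert (Hopp : forall c : C, (- c)%C = (RtoC (-1) * c)%C) by (intros c; ring).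
rewrite !(Hopp (Cdir _)), !Cpow_mult_l.
replace (Cdir (theta n) * ((-1) ^ k * Cdir (theta n) ^ k * m) +
  -1 * (Cdir (- theta n) * ((-1) ^ k * Cdir (- theta n) ^ k * m)))%C
with ((RtoC (-1)) ^ k * m * (Cdir (theta n) ^ (S k) + -1 * Cdir (- theta n) ^ (S k)))%C
by (simpl; ring).
assert (Hm : m <> 0%C).
{ intros E. generalize (moment_zero_pos n k Hn). fold m. rewrite E. simpl. lra. }
apply Cmult_neq_0; [exact airy_factor_neq | apply Cmult_neq_0; [apply Cmult_neq_0 |]].
- apply Cpow_nz. intros E. apply RtoC_inj in E. lra.
- exact Hm.
- rewrite !Cdir_pow. intros E. apply (f_equal Im) in E. unfold Cdir in E.
  rewrite <- Ropp_mult_distr_r, cos_neg, sin_neg in E.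
  assert (S1 : 0 < sin (INR (S k) * theta n)).
  { assert (HN := INR_succ_pos n). assert (HP := PI_RGT_0).
    assert (HS : 0 < INR (S k)) by (apply lt_0_INR; lia).
    assert (HSN : INR (S k) < INR (n + 1)) by (apply lt_INR; lia).
    unfold theta. apply sin_gt_0.
    - apply Rmult_lt_0_compat; [exact HS | now apply Rdiv_lt_0_compat].
    - apply Rmult_lt_reg_r with (INR (n + 1)); [exact HN|].
      replace (INR (S k) * (PI / INR (n + 1)) * INR (n + 1)) with (PI * INR (S k)) by (field; lra).
      now apply Rmult_lt_compat_l. }
  simpl in E. simpl in S1. lra.
Qed.

(** * Linear independence *)

Ltac cring := match goal with |- ?a = ?b => change (@eq C a b); ring end.

Lemma sum_C_plus (a b : nat -> C) (n m : nat) :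
  sum_n_m (fun k => a k + b k)%C n m = (sum_n_m a n m + sum_n_m b n m)%C.
Proof. exact (sum_n_m_plus (G := C_AbelianMonoid) a b n m). Qed.

Lemma sum_C_scal (c : C) (a : nat -> C) (n m : nat) :
  sum_n_m (fun k => c * a k)%C n m = (c * sum_n_m a n m)%C.
Proof. exact (sum_n_m_mult_l (K := C_Ring) c a n m). Qed.

Lemma sum_C_ext (a b : nat -> C) (n m : nat) :
  (forall k, (n <= k <= m)%nat -> a k = b k) -> sum_n_m a n m = sum_n_m b n m.
Proof. exact (sum_n_m_ext_loc (G := C_AbelianMonoid) a b n m). Qed.

Lemma sum_C_S (a : nat -> C) (m : nat) :
  sum_n_m a 1 (S m) = (sum_n_m a 1 m + a (S m))%C.
Proof. apply (sum_n_Sm (G := C_AbelianMonoid)). lia. Qed.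

Lemma sum_C_0 (a : nat -> C) : sum_n_m a 1 0 = RtoC 0.
Proof. apply (sum_n_m_zero (G := C_AbelianMonoid)). lia. Qed.

Lemma vandermonde (m : nat) (x c : nat -> C) :
  (forall k l, (1 <= k <= m)%nat -> (1 <= l <= m)%nat -> x k = x l -> k = l) ->
  (forall j, (j < m)%nat -> sum_n_m (fun k => c k * x k ^ j)%C 1 m = RtoC 0) ->
  forall k, (1 <= k <= m)%nat -> c k = RtoC 0.
Proof.
(* The induction hypothesis is applied to the coefficients [c k * (x k - x (S m))], so [c] must stay
   general. *)
revert c. induction m as [|m IH]; intros c Hx Hs k Hk; [lia|].
(* Subtracting [x (S m)] times the equation of degree [j] from that of degree
   [j + 1] eliminates the last unknown. *)
assert (Hc : forall l, (1 <= l <= m)%nat -> c l = RtoC 0).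
{ intros l Hl.
  assert (D : (c l * (x l - x (S m)) = 0)%C).
  { apply (IH (fun k => c k * (x k - x (S m)))%C); [intros; apply Hx; [lia | lia | assumption] | | exact Hl].
    intros j Hj.
    assert (H1 := Hs (S j) ltac:(lia)). assert (H2 := Hs j ltac:(lia)).
    assert (E : sum_n_m (fun k => c k * (x k - x (S m)) * x k ^ j)%C 1 (S m) = RtoC 0).
    { rewrite (sum_C_ext _ (fun k => c k * x k ^ (S j) + (- x (S m)) * (c k * x k ^ j))%C)
        by (intros; simpl; ring).
      rewrite sum_C_plus, sum_C_scal, H1, H2. cring. }
    rewrite sum_C_S in E.
    replace (c (S m) * (x (S m) - x (S m)) * x (S m) ^ j)%C with (RtoC 0) in E by ring.
    now rewrite Cplus_0_r in E. }
  destruct (Ceq_dec (c l) 0) as [E|E]; [exact E|].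
  destruct (Ceq_dec (x l - x (S m))%C 0) as [E'|E'].
  - assert (l = S m); [ | lia]. apply Hx; try lia.
    replace (x l) with (x l - x (S m) + x (S m))%C by ring. rewrite E'. ring.
  - exfalso. now apply (Cmult_neq_0 _ _ E E'). }
destruct (Nat.eq_dec k (S m)) as [->|Hne]; [ | apply Hc; lia].
(* Once the other coefficients vanish, the equation of degree 0 reduces to the last one. *)
generalize (Hs 0%nat ltac:(lia)). rewrite sum_C_S.
rewrite (sum_C_ext _ (fun k => 0 * c k)%C) by (intros l Hl; rewrite (Hc l Hl); simpl; ring).
rewrite sum_C_scal. simpl. intros H. rewrite <- H. cring.
Qed.

Lemma qderive_sum (m : nat) (f : nat -> C -> C) (l : nat -> C) (z : C) :
  (forall k, (1 <= k <= m)%nat -> qderive (f k) z (l k)) ->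
  qderive (fun z => sum_n_m (fun k => f k z) 1 m) z (sum_n_m l 1 m).
Proof.
induction m as [|m IH]; intros H.
- rewrite sum_C_0. exists 0. intros h _. rewrite !sum_C_0.
  replace (0 - 0 - h * 0)%C with (RtoC 0) by ring. rewrite Cmod_0. lra.
- rewrite sum_C_S.
  destruct (qderive_plus (fun z => sum_n_m (fun k => f k z) 1 m) (f (S m)) z _ (l (S m))
    (IH (fun k Hk => H k ltac:(lia))) (H (S m) ltac:(lia))) as [A HA].
  exists A. intros h Hh. rewrite !sum_C_S. now apply HA.
Qed.

(** Derivatives are unique, and 0 is a derivative of the zero function with remainder constant 0. *)
Lemma qderive_zero (f : C -> C) (z l : C) :
  (forall z, f z = RtoC 0) -> qderive f z l -> l = RtoC 0.
Proof.
intros Hf H. apply qderive_is_derive, is_C_derive_unique in H. rewrite <- H.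
apply is_C_derive_unique, qderive_is_derive. exists 0. intros h _. rewrite !Hf.
replace (0 - 0 - h * 0)%C with (RtoC 0) by ring. rewrite Cmod_0. lra.
Qed.

Lemma airy_lin_indep (n : nat) (b : nat -> C) (g : nat -> C -> C) : (1 <= n)%nat ->
  (forall k, (1 <= k <= n)%nat -> Cmod (b k) = 1) ->
  (forall k l, (1 <= k <= n)%nat -> (1 <= l <= n)%nat -> b k = b l -> k = l) ->
  (forall k z, g k z = airy n 0 (b k) z) ->
  lin_indep n g.
Proof.
intros Hn Hb Hinj Hg c Hc.
(* The relation is kept at every [z], so that it can be differentiated again before specializing to
   0. *)
assert (Hd : forall j z, sum_n_m (fun k => c k * airy n j (b k) z)%C 1 n = RtoC 0).
{ induction j as [|j IH]; intros z.
  - rewrite <- (Hc z). apply sum_C_ext. intros k _. now rewrite Hg.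
  - apply (qderive_zero _ z _ IH).
    apply (qderive_sum n (fun k z => c k * airy n j (b k) z)%C (fun k => c k * airy n (S j) (b k) z)%C).
    intros k Hk. apply qderive_scal, airy_qderive; auto. }
apply vandermonde with (x := b); [exact Hinj|].
intros j Hj.
assert (E := Hd j 0).
rewrite (sum_C_ext _ (fun k => airy n j 1 0 * (c k * b k ^ j))%C) in E
  by (intros k _; rewrite airy_at_0; ring).
rewrite sum_C_scal in E.
destruct (Ceq_dec (sum_n_m (fun k => c k * b k ^ j)%C 1 n) 0) as [E'|E']; [exact E'|].
exfalso. exact (Cmult_neq_0 _ _ (airy_at_0_neq n j Hn Hj) E' E).
Qed.

(** * The order *)

Lemma Cmod_sub_le (x y : C) : Rabs (Cmod x - Cmod y) <= Cmod (x - y)%C.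
Proof.
assert (H1 := Cmod_triangle (x - y) y). replace (x - y + y)%C with x in H1 by ring.
assert (H2 := Cmod_triangle (y - x) x). replace (y - x + x)%C with y in H2 by ring.
replace (y - x)%C with (- (x - y))%C in H2 by ring. rewrite Cmod_opp in H2.
apply Rabs_le. lra.
Qed.

(** On the unit disc of increments the quadratic remainder is dominated by a linear one, so [B] acts
    as a Lipschitz constant at [z]. *)
Lemma qderive_Cmod_continuous (f : C -> C) (z l : C) (eps : posreal) : qderive f z l ->
  exists d : posreal, forall w, Cmod (w - z)%C < d -> Rabs (Cmod (f w) - Cmod (f z)) < eps.
Proof.
intros [A HA].
set (B := Rabs A + Cmod l + 1).
assert (HB : 0 < B) by (unfold B; generalize (Rabs_pos A) (Cmod_ge_0 l); lra).
assert (Hd : 0 < Rmin 1 (eps / B)).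
{ apply Rmin_pos; [lra | apply Rdiv_lt_0_compat; [apply eps | exact HB]]. }
exists (mkposreal _ Hd). simpl. intros w Hw.
assert (H1 : Cmod (w - z)%C < 1) by (apply Rlt_le_trans with (1 := Hw), Rmin_l).
assert (H2 : Cmod (w - z)%C < eps / B) by (apply Rlt_le_trans with (1 := Hw), Rmin_r).
apply Rle_lt_trans with (1 := Cmod_sub_le _ _).
set (h := (w - z)%C) in *.
assert (H3 := HA h (Rlt_le _ _ H1)).
replace (z + h)%C with w in H3 by (unfold h; ring).
replace (f w - f z)%C with (f w - f z - h * l + h * l)%C by ring.
apply Rle_lt_trans with (1 := Cmod_triangle _ _). rewrite Cmod_mult.
apply Rle_lt_trans with (B * Cmod h).
- assert (A * Cmod h ^ 2 <= Rabs A * Cmod h).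
  { apply Rle_trans with (Rabs A * Cmod h ^ 2).
    - apply Rmult_le_compat_r; [apply pow2_ge_0 | apply Rle_abs].
    - apply Rmult_le_compat_l; [apply Rabs_pos|]. generalize (Cmod_ge_0 h); nra. }
  unfold B. generalize (Cmod_ge_0 h) (Rabs_pos A); nra.
- apply Rmult_lt_reg_r with (/ B); [now apply Rinv_0_lt_compat|].
  replace (B * Cmod h * / B) with (Cmod h) by (field; lra). exact H2.
Qed.

(** The circle will be cut into two graphs over [[- r, r]], so the extreme value theorem on a real
    interval replaces compactness in the plane. *)
Lemma arc_max (f : C -> C) (r : R) (y : R -> R) : 0 < r ->
  (forall z, exists l, qderive f z l) -> (forall t, continuous y t) ->
  exists t, - r <= t <= r /\ forall t', - r <= t' <= r -> Cmod (f (t', y t')) <= Cmod (f (t, y t)).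
Proof.
intros Hr Hf Hy.
destruct (continuity_ab_maj (fun t => Cmod (f (t, y t))) (- r) r) as [t [Ht1 Ht2]].
- lra.
- intros t _. apply continuity_pt_filterlim. intros P [eps HP].
  destruct (Hf (t, y t)) as [l Hl].
  destruct (qderive_Cmod_continuous f _ l eps Hl) as [d Hd].
  assert (Hd2 : 0 < d / 2) by (generalize (cond_pos d); lra).
  destruct (Hy t (ball (y t) (mkposreal _ Hd2))) as [d' Hd'].
  { now exists (mkposreal _ Hd2). }
  assert (Hm : 0 < Rmin (d / 2) d') by (apply Rmin_pos; [lra | apply cond_pos]).
  exists (mkposreal _ Hm). intros t' Ht'.
  apply HP. apply Hd.
  apply Rle_lt_trans with (1 := Cmod_le_Re_Im _).
  assert (B1 : Rabs (t' - t) < Rmin (d / 2) d') by exact Ht'.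
  assert (B2 : Rabs (y t' - y t) < d / 2).
  { apply Hd'. apply Rlt_le_trans with (1 := B1), Rmin_r. }
  assert (B3 : Rabs (t' - t) < d / 2) by (apply Rlt_le_trans with (1 := B1), Rmin_l).
  change (Rabs (t' - t) + Rabs (y t' - y t) < d). lra.
- exists t. split; [exact Ht2 | exact Ht1].
Qed.

Lemma max_modulus_exists (f : C -> C) (r : R) : 0 < r ->
  (forall z, exists l, qderive f z l) -> exists M, is_max_modulus f r M.
Proof.
intros Hr Hf.
set (y := fun t => sqrt (r ^ 2 - t ^ 2)).
(* Continuity holds on the whole line because [sqrt] is 0 at negative arguments. *)
assert (Hy : forall t, continuous y t).
{ intros t. apply continuous_sqrt_comp.
  apply (ex_derive_continuous (V := R_NormedModule)). now auto_derive. }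
destruct (arc_max f r y Hr Hf Hy) as [t1 [H1 M1]].
destruct (arc_max f r (fun t => - y t) Hr Hf) as [t2 [H2 M2]].
{ intros t. apply (continuous_opp (V := R_NormedModule)), Hy. }
assert (Hc : forall t, - r <= t <= r -> Cmod (t, y t) = r /\ Cmod (t, - y t) = r).
{ intros t Ht. unfold Cmod; simpl fst; simpl snd.
  replace ((- y t) ^ 2) with (y t ^ 2) by ring.
  unfold y. rewrite pow2_sqrt by nra.
  replace (t ^ 2 + (r ^ 2 - t ^ 2)) with (r ^ 2) by ring.
  rewrite sqrt_pow2 by lra. easy. }
assert (HM : forall z, Cmod z = r -> Cmod (f z) <= Rmax (Cmod (f (t1, y t1))) (Cmod (f (t2, - y t2)))).
{ intros [a b] Hz.
  assert (Ha : - r <= a <= r).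
  { generalize (Re_le_Cmod (a, b)). rewrite Hz. apply Rabs_le_between. }
  assert (Hb : b ^ 2 = r ^ 2 - a ^ 2).
  { rewrite <- Hz. unfold Cmod. simpl fst; simpl snd. rewrite pow2_sqrt; [ring|].
    apply Rplus_le_le_0_compat; apply pow2_ge_0. }
  destruct (Rle_dec 0 b) as [Hb0|Hb0].
  - apply Rle_trans with (2 := Rmax_l _ _).
    replace b with (y a); [now apply M1|]. unfold y. rewrite <- Hb. now apply sqrt_pow2.
  - apply Rle_trans with (2 := Rmax_r _ _).
    replace b with (- y a); [now apply M2|]. unfold y. rewrite <- Hb.
    replace (b ^ 2) with ((- b) ^ 2) by ring. rewrite sqrt_pow2; lra. }
exists (Rmax (Cmod (f (t1, y t1))) (Cmod (f (t2, - y t2)))). split; [ | exact HM].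
unfold Rmax. destruct (Rle_dec _ _); [exists (t2, - y t2) | exists (t1, y t1)];
  (split; [now apply Hc | reflexivity]).
Qed.

(** Writing [r = s ^ n] turns [s ^ (n + 1)] into [r] to the power [1 + 1 / n], so the two bounds
    together say that [ln (ln (M r))] is [(1 + 1 / n) * ln r] up to a bounded error. *)
Lemma is_order_of_bounds (n : nat) (f : C -> C) (C1 C2 s0 : R) : (1 <= n)%nat ->
  0 < C1 -> 0 < C2 ->
  (forall z, exists l, qderive f z l) ->
  (forall s z, s0 <= s -> Cmod z = s ^ n -> Cmod (f z) <= exp (C2 * s ^ (n + 1))) ->
  (forall s, s0 <= s -> exists z, Cmod z = s ^ n /\ exp (C1 * s ^ (n + 1)) <= Cmod (f z)) ->
  is_order f (Finite (1 + 1 / INR n)).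
Proof.
intros Hn HC1 HC2 Hf Hup Hlow.
assert (HM : forall r, exists M, 0 < r -> is_max_modulus f r M).
{ intros r. destruct (Rlt_dec 0 r) as [Hr|Hr].
  - destruct (max_modulus_exists f r Hr Hf) as [M HM]. now exists M.
  - exists 0. intros H. contradiction. }
(* The maxima at the various radii are gathered into one function; its value at [r <= 0] is
   arbitrary. *)
destruct (functional_choice _ HM) as [M HMr].
exists M. split; [exact HMr|].
assert (HN : 0 < INR n) by (apply lt_0_INR; lia).
set (l := 1 + 1 / INR n).
set (L := Rabs (ln C1) + Rabs (ln C2)).
(* Beyond [r0], the radius is at least 1 and its [n]-th root, the [s] below, is at least [s0]. *)
set (r0 := Rmax 1 (Rmax 1 s0 ^ n)).
assert (Hb : forall r, r0 <= r ->
  ln C1 + l * ln r <= ln (ln (M r)) <= ln C2 + l * ln r).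
{ intros r Hr.
  assert (Hr1 : 1 <= r) by (apply Rle_trans with (2 := Hr), Rmax_l).
  assert (Hr2 : Rmax 1 s0 ^ n <= r) by (apply Rle_trans with (2 := Hr), Rmax_r).
  set (s := exp (ln r / INR n)).
  assert (Hs : 0 < s) by apply exp_pos.
  assert (Hsn : s ^ n = r).
  { unfold s. rewrite <- Rpower_pow by apply exp_pos. unfold Rpower. rewrite ln_exp.
    replace (INR n * (ln r / INR n)) with (ln r) by (field; lra). apply exp_ln; lra. }
  assert (Hss : Rmax 1 s0 <= s).
  { assert (Hm : 0 < Rmax 1 s0) by (apply Rlt_le_trans with (2 := Rmax_l 1 s0); lra).
    rewrite <- (exp_ln (Rmax 1 s0)) by exact Hm. apply exp_le_compat.
    apply Rmult_le_reg_l with (INR n); [exact HN|].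
    replace (INR n * (ln r / INR n)) with (ln r) by (field; lra).
    rewrite <- ln_pow by exact Hm. apply ln_le; [now apply pow_lt | exact Hr2]. }
  assert (Hs0 : s0 <= s) by (apply Rle_trans with (2 := Hss), Rmax_r).
  assert (Hlns : ln (s ^ (n + 1)) = l * ln r).
  { rewrite pow_add, pow_1, Hsn, ln_mult by lra. unfold s at 1. rewrite ln_exp.
    unfold l. field. lra. }
  assert (Hsp : 0 < s ^ (n + 1)) by now apply pow_lt.
  destruct (HMr r ltac:(lra)) as [[z [Hz Ez]] Hmax].
  destruct (Hlow s Hs0) as [w [Hw Ew]].
  assert (U : M r <= exp (C2 * s ^ (n + 1))).
  { rewrite <- Ez. apply Hup; [exact Hs0 | now rewrite Hsn]. }
  assert (V : exp (C1 * s ^ (n + 1)) <= M r).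
  { apply Rle_trans with (1 := Ew), Hmax. now rewrite Hw. }
  assert (P1 : 0 < C1 * s ^ (n + 1)) by now apply Rmult_lt_0_compat.
  assert (V' : C1 * s ^ (n + 1) <= ln (M r)).
  { rewrite <- (ln_exp (C1 * s ^ (n + 1))). apply ln_le; [apply exp_pos | exact V]. }
  assert (U' : ln (M r) <= C2 * s ^ (n + 1)).
  { rewrite <- (ln_exp (C2 * s ^ (n + 1))). apply ln_le; [ | exact U].
    apply Rlt_le_trans with (2 := V), exp_pos. }
  rewrite <- Hlns, <- !ln_mult by assumption.
  split; apply ln_le; lra. }
(* The quotient has a genuine limit, from which both halves of the upper limit follow. *)
assert (Hlim : forall eps : posreal, exists A, forall r, A <= r ->
  l - eps < ln (ln (M r)) / ln r < l + eps).
{ intros eps.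
  (* Once [ln r >= B], the bounded error, at most [L], is less than [eps * ln r]. *)
  set (B := (L + 1) / eps).
  assert (HL : 0 <= L) by (unfold L; generalize (Rabs_pos (ln C1)) (Rabs_pos (ln C2)); lra).
  assert (HB : 0 < B) by (apply Rdiv_lt_0_compat; [lra | apply cond_pos]).
  exists (Rmax r0 (exp B)). intros r Hr.
  assert (R1 : r0 <= r) by (apply Rle_trans with (2 := Hr), Rmax_l).
  assert (R2 : exp B <= r) by (apply Rle_trans with (2 := Hr), Rmax_r).
  assert (R3 : B <= ln r).
  { rewrite <- (ln_exp B). apply ln_le; [apply exp_pos | exact R2]. }
  destruct (Hb r R1) as [X1 X2].
  assert (E : L < eps * ln r).
  { apply Rlt_le_trans with (eps * B).
    - unfold B. replace (eps * ((L + 1) / eps)) with (L + 1) by (field; generalize (cond_pos eps); lra). lra.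
    - apply Rmult_le_compat_l; [apply Rlt_le, cond_pos | exact R3]. }
  assert (L1 : - L <= ln C1).
  { unfold L. generalize (Rle_abs (- ln C1)) (Rabs_pos (ln C2)). rewrite Rabs_Ropp. lra. }
  assert (L2 : ln C2 <= L).
  { unfold L. generalize (Rle_abs (ln C2)) (Rabs_pos (ln C1)). lra. }
  split; apply Rmult_lt_reg_r with (ln r); try lra;
    unfold Rdiv; rewrite Rmult_assoc, Rinv_l by lra; lra. }
intros eps. split.
- intros A. destruct (Hlim eps) as [A' HA']. exists (Rmax A A'). split; [apply Rmax_l|].
  apply HA', Rmax_r.
- destruct (Hlim eps) as [A HA]. exists A. intros r Hr. apply HA, Hr.
Qed.

(** * Growth bounds for the solutions *)

(** Young's inequality bounds each ray integral by the same [E], with [1 <= s] freeing the decay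
    [exp (- r)]. The sum divided by [2 * PI] is [E / PI], at most [E]. *)
Lemma airy_upper (n : nat) (b z : C) (s : R) : (1 <= n)%nat -> Cmod b = 1 -> 1 <= s ->
  Cmod z = s ^ n -> Cmod (airy n 0 b z) <= exp (4 * INR (n + 1) * s ^ (n + 1)).
Proof.
intros Hn Hb Hs Hz.
assert (Hbr : forall a, Cmod a = 1 -> Cmod (branch n 0 a z) <= exp (4 * INR (n + 1) * s ^ (n + 1))).
{ intros a Ha. unfold branch. simpl. rewrite Cmult_1_l.
  apply ray_int_bound; [now apply good_kern|]. intros r Hr.
  rewrite Cmod_kern by exact Hr. unfold damp. simpl. rewrite Rmult_1_l, <- !exp_plus.
  apply exp_le_compat.
  assert (Hre : Re (a * z)%C <= s ^ n).
  { apply Rle_trans with (1 := Rle_abs _). apply Rle_trans with (1 := Re_le_Cmod _).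
    rewrite Cmod_mult, Ha, Hz. lra. }
  generalize (young_pow n r s Hn Hr ltac:(lra)).
  assert (1 <= s ^ n) by now apply pow_R1_Rle.
  assert (Re (a * z)%C * r <= s ^ n * r) by now apply Rmult_le_compat_r.
  assert (1 * r <= s ^ n * r) by now apply Rmult_le_compat_r.
  simpl in *. lra. }
unfold airy. rewrite Cmod_mult, Cmod_airy_factor.
set (E := exp _) in *.
assert (HE : 0 < E) by apply exp_pos.
apply Rle_trans with (/ (2 * PI) * (E + E)).
- apply Rmult_le_compat_l.
  + apply Rlt_le, Rinv_0_lt_compat. generalize PI_RGT_0; lra.
  + apply Rle_trans with (1 := Cmod_triangle _ _).
    rewrite !Cmod_mult, !Cmod_Cdir, Cmod_R, Rabs_left, !Rmult_1_l by lra.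
    replace (- -1) with 1 by ring. rewrite Rmult_1_l.
    apply Rplus_le_compat; apply Hbr; now apply Cmod_ray.
- assert (HP := PI2_1). 
  replace (/ (2 * PI) * (E + E)) with (E / PI) by (field; lra).
  apply Rmult_le_reg_r with PI; [lra|].
  replace (E / PI * PI) with E by (field; lra). nra.
Qed.

(** The modulus of the kernel at [c] is the kernel at [Re c], which trades a complex parameter for a
    real one. *)
Lemma moment_Re_le (n : nat) (c : C) : (1 <= n)%nat ->
  Cmod (moment n 0 c) <= Re (moment n 0 (RtoC (Re c))).
Proof.
intros Hn. apply ray_int_le; try (now apply good_kern).
intros r Hr. rewrite Cmod_kern by exact Hr.
unfold kern. rewrite <- RtoC_mult, Cexp_RtoC, <- RtoC_pow, <- !RtoC_mult. apply Rle_refl.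
Qed.

(** The integrand of the difference is nonnegative, so the window [[s / 2, s]] suffices. There the
    second exponential is at most half the first, and since [r <= s] the damping costs at most half
    of the exponent [s ^ n * r], itself at least [s ^ (n + 1) / 2]. *)
Lemma moment_gap (n : nat) (g s : R) : (1 <= n)%nat -> g < 1 -> 1 <= s -> 2 / (1 - g) <= s ->
  exp (s ^ (n + 1) / 4) / 4 <= Re (moment n 0 (RtoC (s ^ n))) - Re (moment n 0 (RtoC (g * s ^ n))).
Proof.
intros Hn Hg Hs Hsg.
set (h := fun r => (kern n 0 (RtoC (s ^ n)) r + RtoC (-1) * kern n 0 (RtoC (g * s ^ n)) r)%C).
assert (G1 := good_kern n 0 (RtoC (s ^ n)) Hn).
assert (G2 := good_kern n 0 (RtoC (g * s ^ n)) Hn).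
assert (G3 := good_scal (RtoC (-1)) _ G2).
assert (E : Re (moment n 0 (RtoC (s ^ n))) - Re (moment n 0 (RtoC (g * s ^ n))) = Re (ray_int h)).
{ unfold h. rewrite (ray_int_plus _ _ G1 G3), (ray_int_scal _ _ G2).
  fold (moment n 0 (s ^ n)%R) (moment n 0 (g * s ^ n)%R).
  unfold Re; simpl. ring. }
assert (Eh : forall r, Re (h r) = (exp (s ^ n * r) - exp (g * s ^ n * r)) * damp n r).
{ intros r. unfold h, kern. rewrite <- !RtoC_mult, !Cexp_RtoC, <- RtoC_pow, <- !RtoC_mult, <- RtoC_plus.
  simpl. ring. }
assert (HR : s <= s ^ n) by (rewrite <- (pow_1 s) at 1; now apply Rle_pow).
rewrite E.
(* The window has length at least [1 / 2], whence the final divisor 4. *)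
apply Rle_trans with (exp (s ^ (n + 1) / 4) / 2 * (s - s / 2)).
- generalize (exp_pos (s ^ (n + 1) / 4)). nra.
- apply ray_int_lower.
  + exact (good_plus _ _ G1 G3).
  + intros r Hr. rewrite Eh. apply Rmult_le_pos; [ | apply Rlt_le, damp_pos].
    assert (exp (g * s ^ n * r) <= exp (s ^ n * r)); [ | lra].
    apply exp_le_compat. apply Rmult_le_compat_r; [exact Hr|]. nra.
  + lra.
  + intros r Hr. rewrite Eh.
    assert (Hexp : exp (g * s ^ n * r) <= exp (s ^ n * r) / 2).
    { replace (g * s ^ n * r) with (s ^ n * r + - ((1 - g) * (s ^ n * r))) by ring.
      rewrite exp_plus. apply Rmult_le_compat_l; [apply Rlt_le, exp_pos|].
      (* A gap of 1 between the exponents gives the factor [1 / 2], by [1 + t <= exp t]. *)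
      assert (H1 : 1 <= (1 - g) * (s ^ n * r)).
      { assert (2 <= s * (1 - g)).
        { apply Rmult_le_reg_r with (/ (1 - g)); [apply Rinv_0_lt_compat; lra|].
          rewrite Rmult_assoc, Rinv_r by lra. unfold Rdiv in Hsg. lra. }
        assert (s * (1 / 2) <= s ^ n * r) by (apply Rmult_le_compat; lra).
        nra. }
      rewrite exp_Ropp. apply Rinv_le_contravar; [lra|].
      apply Rle_trans with (1 + (1 - g) * (s ^ n * r)); [lra | apply exp_ineq1_le]. }
    apply Rle_trans with (exp (s ^ n * r) / 2 * damp n r).
    * replace (exp (s ^ n * r) / 2 * damp n r) with (exp (s ^ n * r) * damp n r / 2) by field.
      apply Rmult_le_compat_r; [lra|]. unfold damp. rewrite <- exp_plus. apply exp_le_compat.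
      rewrite !pow_add, !pow_1.
      assert (HN : 2 <= INR (n + 1))
        by (replace 2 with (INR 2) by reflexivity; apply le_INR; lia).
      assert (r ^ n <= s ^ n) by (apply pow_incr; lra).
      assert (H2 : r ^ n * r / INR (n + 1) <= s ^ n * r / 2).
      { apply Rmult_le_compat.
        - apply Rmult_le_pos; [apply pow_le; lra | lra].
        - apply Rlt_le, Rinv_0_lt_compat; lra.
        - apply Rmult_le_compat_r; lra.
        - apply Rinv_le_contravar; lra. }
      assert (s ^ n * (s / 2) <= s ^ n * r) by (apply Rmult_le_compat_l; lra).
      lra.
    * apply Rmult_le_compat_r; [apply Rlt_le, damp_pos | lra].
Qed.

(** The angle [2 * PI / (n + 1)] lies in [(0, PI]], where the cosine is strictly below 1. *)
Lemma cos_2theta_lt_1 (n : nat) : (1 <= n)%nat -> cos (2 * theta n) < 1.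
Proof.
intros Hn. assert (HP := PI_RGT_0). assert (HN := INR_succ_pos n).
assert (HN2 : 2 <= INR (n + 1)) by (replace 2 with (INR 2) by reflexivity; apply le_INR; lia).
rewrite <- cos_0. unfold theta. apply cos_decreasing_1; try lra.
- apply Rlt_le, Rmult_lt_0_compat; [lra | now apply Rdiv_lt_0_compat].
- apply Rmult_le_reg_r with (INR (n + 1)); [exact HN|].
  replace (2 * (PI / INR (n + 1)) * INR (n + 1)) with (2 * PI) by (field; lra). nra.
- apply Rmult_lt_0_compat; [lra | now apply Rdiv_lt_0_compat].
Qed.

(* In the direction chosen here, [- w b z] is real and positive along the
   upper ray of the contour, while along the lower ray its real part is smaller by the
   factor [cos (2 theta) < 1]; no cancellation can occur. *)
Lemma airy_lower (n : nat) (b : C) (s : R) : (1 <= n)%nat -> Cmod b = 1 ->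
  1 <= s -> 2 / (1 - cos (2 * theta n)) <= s -> 64 * PI <= s ->
  exists z, Cmod z = s ^ n /\ exp (/ 8 * s ^ (n + 1)) <= Cmod (airy n 0 b z).
Proof.
intros Hn Hb Hs Hs1 Hs2.
set (g := cos (2 * theta n)) in *.
set (a := (- Cdir (theta n) * b)%C).
assert (Ha : Cmod a = 1) by now apply Cmod_ray.
assert (Ha0 : a <> 0%C) by (intros E; rewrite E, Cmod_0 in Ha; lra).
set (z := (/ a * RtoC (s ^ n))%C).
assert (Psn : 0 <= s ^ n) by (apply pow_le; lra).
exists z. split.
{ unfold z. rewrite Cmod_mult, Cmod_inv, Ha, Cmod_R, Rabs_pos_eq by assumption. field. }
assert (E1 : (a * z)%C = RtoC (s ^ n)).
{ unfold z. rewrite Cmult_assoc, Cinv_r, Cmult_1_l; trivial. }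
(* The two directions differ by the angle [2 * theta n], so the real part on the lower ray is
   multiplied by [g]. *)
assert (E2 : (- Cdir (- theta n) * b * z)%C = (Cdir (- (2 * theta n)) * RtoC (s ^ n))%C).
{ rewrite <- E1. unfold a. replace (- theta n) with (- (2 * theta n) + theta n) at 1 by ring.
  rewrite Cdir_plus. ring. }
assert (R2 : Re (Cdir (- (2 * theta n)) * RtoC (s ^ n))%C = g * s ^ n).
{ unfold Cdir, Re. simpl. rewrite cos_neg. unfold g. ring. }
unfold airy. rewrite Cmod_mult, Cmod_airy_factor. unfold branch. fold a. rewrite E1, E2. simpl (_ ^ 0)%C.
set (m1 := moment n 0 (RtoC (s ^ n))). set (m2 := moment n 0 (Cdir _ * _)%C).
assert (Hm2 : Cmod m2 <= Re (moment n 0 (RtoC (g * s ^ n)))).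
{ rewrite <- R2. now apply moment_Re_le. }
assert (Hm1 : Re m1 <= Cmod m1) by (apply Rle_trans with (2 := Re_le_Cmod m1), Rle_abs).
assert (Hgap := moment_gap n g s Hn (cos_2theta_lt_1 n Hn) Hs Hs1). fold m1 in Hgap.
assert (HT : Cmod m1 - Cmod m2 <=
  Cmod (Cdir (theta n) * (1 * m1) + RtoC (-1) * (Cdir (- theta n) * (1 * m2)))%C).
{ set (A := (Cdir (theta n) * (1 * m1))%C). set (B := (Cdir (- theta n) * (1 * m2))%C).
  replace (Cmod m1) with (Cmod A) by (unfold A; rewrite !Cmod_mult, Cmod_Cdir, Cmod_1; ring).
  replace (Cmod m2) with (Cmod B) by (unfold B; rewrite !Cmod_mult, Cmod_Cdir, Cmod_1; ring).
  replace (A + RtoC (-1) * B)%C with (A - B)%C by ring.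
  apply Rle_trans with (2 := Cmod_sub_le A B), Rle_abs. }
set (T := Cmod (_ + _)%C) in *.
set (X := s ^ (n + 1)) in *.
assert (HP := PI_RGT_0).
assert (HX : 64 * PI <= X).
{ apply Rle_trans with (1 := Hs2). unfold X. rewrite <- (pow_1 s) at 1. apply Rle_pow; [exact Hs | lia]. }
(* One of the two equal exponential factors is spent on the constants: it is at least [8 * PI]
   because [X >= 64 * PI], which covers the divisor 4 and the prefactor [/ (2 * PI)]. *)
replace (X / 4) with (/ 8 * X + / 8 * X) in Hgap by field. rewrite exp_plus in Hgap.
assert (HE : 8 * PI <= exp (/ 8 * X)).
{ apply Rle_trans with (1 + / 8 * X); [lra | apply exp_ineq1_le]. }
assert (HE0 := exp_pos (/ 8 * X)).
apply Rmult_le_reg_l with (2 * PI); [lra|].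
replace (2 * PI * (/ (2 * PI) * T)) with T by (field; lra).
set (E := exp (/ 8 * X)) in *.
apply Rle_trans with (E * E / 4); [nra | lra].
Qed.

Lemma airy_order (n : nat) (b : C) (f : C -> C) : (1 <= n)%nat -> Cmod b = 1 ->
  (forall z, f z = airy n 0 b z) -> is_order f (Finite (1 + 1 / INR n)).
Proof.
intros Hn Hb Hf.
apply is_order_of_bounds with (C1 := / 8) (C2 := 4 * INR (n + 1))
  (s0 := Rmax 1 (Rmax (2 / (1 - cos (2 * theta n))) (64 * PI))).
- exact Hn.
- lra.
- generalize (INR_succ_pos n); lra.
- intros z. exists (airy n 1 b z). destruct (airy_qderive n 0 b z Hn Hb) as [A HA].
  exists A. intros h Hh. rewrite !Hf. now apply HA.
- intros s z Hs Hz. rewrite Hf. apply airy_upper; trivial.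
  apply Rle_trans with (2 := Hs), Rmax_l.
- intros s Hs.
  assert (H1 := Rmax_l 1 (Rmax (2 / (1 - cos (2 * theta n))) (64 * PI))).
  assert (H2 := Rmax_r 1 (Rmax (2 / (1 - cos (2 * theta n))) (64 * PI))).
  assert (H3 := Rmax_l (2 / (1 - cos (2 * theta n))) (64 * PI)).
  assert (H4 := Rmax_r (2 / (1 - cos (2 * theta n))) (64 * PI)).
  destruct (airy_lower n b s Hn Hb) as [z [Hz Ez]]; try lra.
  exists z. now rewrite Hf.
Qed.

Theorem theorem4 :
  forall (n : nat) (beta : nat -> C),
    (2 <= n)%nat ->
    (forall j : nat, (1 <= j <= n + 1)%nat ->
       (beta j ^ (n + 1))%C = RtoC 1) ->
    (forall i j : nat, (1 <= i <= n + 1)%nat -> (1 <= j <= n + 1)%nat ->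
       beta i = beta j -> i = j) ->
    let f := fun (j : nat) (z : C) => u n (beta j * z)%C in
    (forall j : nat, (1 <= j <= n + 1)%nat ->
       is_solution n (f j) /\ is_order (f j) (Finite (1 + 1 / INR n))) /\
    (forall s : nat -> nat,
       (forall k : nat, (1 <= k <= n)%nat -> (1 <= s k <= n + 1)%nat) ->
       (forall k l : nat, (1 <= k <= n)%nat -> (1 <= l <= n)%nat ->
          s k = s l -> k = l) ->
       lin_indep n (fun k : nat => f (s k))).
Proof.
intros n beta Hn Hroot Hinj f.
assert (Hn1 : (1 <= n)%nat) by lia.
assert (Hmod : forall j, (1 <= j <= n + 1)%nat -> Cmod (beta j) = 1)
  by (intros j Hj; exact (unit_root_Cmod _ _ (Hroot j Hj))).
assert (Hf : forall j z, f j z = airy n 0 (beta j) z) by (intros; now apply u_airy).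
split.
- intros j Hj. split.
  + apply airy_is_solution with (beta j); auto.
  + apply airy_order with (beta j); auto.
(* Since [s] and [beta] are both injective, the selected roots are distinct nodes, whichever root is
   left out. *)
- intros s Hs Hsinj. apply airy_lin_indep with (fun k => beta (s k)); auto.
Qed.
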